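(* Suppose $\|X\|\le U$ and $|\xi|\le c_\xi$ almost surely for constants $U,c_\xi>0$. There exists a numerical constant $C>0$ such that, for all $t>0$, all $S\in\mathcal S$ and all $\varepsilon\ge0$, with probability at least $1-e^{-t}$ $$\|\hat\rho^{\varepsilon}-S\|_{L_2(\Pi)}^2\le\|S-\rho\|_{L_2(\Pi)}^2+C\max\Bigl\{\varepsilon(\|\log S\|\wedge\log\Gamma),\ \|S-\rho\|_{L_2(\Pi)}U\sqrt{\frac{t_m}n},\ (\sigma_\xi\sigma_X\vee\sigma_\xi\|\mathbb EX\|\vee\sigma_{X\otimes X})\sqrt{\frac{t_m}n},\ (c_\xi U\vee U^2)\frac{t_m}n\Bigr\}$$ and $$\|\hat\rho^{\varepsilon}-\rho\|_{L_2(\Pi)}^2\le\|S-\rho\|_{L_2(\Pi)}^2+C\max\Bigl\{\varepsilon(\|\log S\|\wedge\log\Gamma),\ \|S-\rho\|_{L_2(\Pi)}U\sqrt{\frac{t_m}n},\ (\sigma_\xi\sigma_X\vee\sigma_\xi\|\mathbb EX\|\vee\sigma_{X\otimes X})\sqrt{\frac{t_m}n},\ (c_\xi U\vee U^2)\frac{t_m}n\Bigr\},$$ where $$\Gamma:=\frac{m\,(\mathbb E\|X\|^2)^{1/2}}{\sqrt\varepsilon}\vee m.$$ In particular, $$\|\hat\rho^{\varepsilon}-\rho\|_{L_2(\Pi)}^2\le C\max\Bigl\{\varepsilon(\|\log\rho\|\wedge\log\Gamma),\ (\sigma_\xi\sigma_X\vee\sigma_\xi\|\mathbb EX\|\vee\sigma_{X\otimes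 X})\sqrt{\frac{t_m}n},\ (c_\xi U\vee U^2)\frac{t_m}n\Bigr\}.$$
   Context: Notation: $\mathbb M_m(\mathbb C)$ is the set of complex $m\times m$ matrices, $\langle A,B\rangle=\mathrm{tr}(AB^* )$, $\|\cdot\|$ is the operator norm. $\mathcal S=\{S\in\mathbb M_m(\mathbb C):S=S^*,\ S\ge0,\ \mathrm{tr}(S)=1\}$. $a\vee b=\max(a,b)$, $a\wedge b=\min(a,b)$. $\otimes$ is the tensor (Kronecker) product. Model: $\rho\in\mathcal S$ is unknown; $X,X_1,\dots,X_n$ are i.i.d. random Hermitian $m\times m$ matrices with distribution $\Pi$; $\xi,\xi_1,\dots,\xi_n$ are i.i.d. real random variables independent of the $X$'s with $\mathbb E\xi=0$, $\sigma_\xi^2=\mathbb E\xi^2<\infty$; $Y_j=\mathrm{tr}(\rho X_j)+\xi_j$. For $\varepsilon\ge0$, $$\hat\rho^{\varepsilon}\in\operatorname{argmin}_{S\in\mathcal S}\Bigl[n^{-1}\sum_{j=1}^n(Y_j-\mathrm{tr}(SX_j))^2+\varepsilon\,\mathrm{tr}(S\log S)\Bigr]$$ (with $0\log0=0$). $\|A\|_{L_2(\Pi)}^2=\mathbb E|\langle A,X\rangle|^2$. $\sigma_X^2=\|\mathbb E(X-\mathbb EX)^2\|$, $\sigma_{X\otimes X}^2=\|\mathbb E(X\otimes X-\mathbb E(X\otimes X))^2\|$, $t_m=t+\log(2m)$. Conventions: $\|\log S\|=+\infty$ if $\mathrm{rank}(S)<m$; for $\varepsilon=0$ the term $\varepsilon(\|\log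 S\|\wedge\log\Gamma)$ is read as $0$. *)

(* Defs.v *)
From HB Require Import structures.
From mathcomp Require Import all_boot all_order all_algebra.
From mathcomp Require Import complex mxtens.
From mathcomp Require Import all_classical all_reals all_analysis.

Set Implicit Arguments.
Unset Strict Implicit.
Unset Printing Implicit Defensive.

Import Order.TTheory GRing.Theory Num.Theory.

Local Open Scope classical_set_scope.
Local Open Scope ring_scope.
Local Open Scope complex_scope.
Local Open Scope sesquilinear_scope.

Section Matrices.
Context {R : realType}.
Local Notation C := R[i].

Definition hs_inner m (A B : 'M[C]_m) : C := \tr (A *m B ^t*).

Definition vec_norm m (x : 'cV[C]_m) : R :=
  Num.sqrt (\sum_i Normc.normc (x i 0) ^+ 2).

Definition opnorm m (A : 'M[C]_m) : R :=
  sup [set vec_norm (A *m x) | x in [set x : 'cV[C]_m | vec_norm x <= 1]].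

(* The order on C is partial: [0 <= z] also says that z is real. *)
Definition psd m (A : 'M[C]_m) : Prop :=
  forall x : 'cV[C]_m, 0 <= (x ^t* *m A *m x) 0 0.

Definition density m : set 'M[C]_m :=
  [set S | [/\ S \is hermsymmx, psd S & \tr S = 1]].

(* Hermitian functional calculus: if A = P^-1 diag(d) P is the spectral
   decomposition of A, then [mxfun f A] = P^-1 diag(f d) P. *)
Definition mxfun m (f : R -> R) (A : 'M[C]_m) : 'M[C]_m :=
  invmx (spectralmx A) *m
  diag_mx (map_mx (fun z : C => (f (complex.Re z))%:C) (spectral_diag A)) *m
  spectralmx A.

(* Since [ln 0 = 0], [logm S] vanishes on the kernel of S, so that
   [tr_xlogx S] obeys 0 log 0 = 0. *)
Definition logm m (S : 'M[C]_m) : 'M[C]_m := mxfun (@ln R) S.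

Definition tr_xlogx m (S : 'M[C]_m) : R := complex.Re (\tr (S *m logm S)).

Definition norm_log m (S : 'M[C]_m) : \bar R :=
  if (\rank S < m)%N then +oo%E else (opnorm (logm S))%:E.

Definition mx_borel m : set (set 'M[C]_m) :=
  <<s [set A | exists (i j : 'I_m) (B : set R), measurable B /\
        (A = [set M : 'M[C]_m | B (complex.Re (M i j))] \/
         A = [set M : 'M[C]_m | B (complex.Im (M i j))])] >>.

End Matrices.

Arguments mx_borel {R} m _.

Section Probability.
Context {R : realType} {d : measure_display} {T : measurableType d}.
Variable P : probability T R.
Local Notation C := R[i].

Definition mean (f : T -> R) : R := fine ('E_P[f])%E.

Definition mxmean p q (Z : T -> 'M[C]_(p, q)) : 'M[C]_(p, q) :=
  \matrix_(i, j) (mean (fun w => complex.Re (Z w i j)) +i*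
                  mean (fun w => complex.Im (Z w i j))).

Definition events_of V (G : set (set V)) (Z : T -> V) : set (set T) :=
  [set Z @^-1` B | B in G].

Definition random_mx m (Z : T -> 'M[C]_m) : Prop :=
  events_of (mx_borel m) Z `<=` measurable.

Definition same_law V (G : set (set V)) (Z Z' : T -> V) : Prop :=
  forall B, G B -> P (Z @^-1` B) = P (Z' @^-1` B).

Definition mutually_independent (I : finType) (F : I -> set (set T)) : Prop :=
  forall (J : {set I}) (E : I -> set T), (forall i, i \in J -> F i (E i)) ->
    (P (\bigcap_(i in [set` J]) E i) = \prod_(i in J) P (E i))%E.

Definition independent (F G : set (set T)) : Prop :=
  forall A B, F A -> G B -> P (A `&` B) = (P A * P B)%E.

Definition iid (I : finType) V (G : set (set V)) (Z : I -> T -> V) : Prop :=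
  mutually_independent (fun i => events_of G (Z i)) /\
  forall i j, same_law G (Z i) (Z j).

Definition joint_events (I : finType) V (G : set (set V)) (Z : I -> T -> V) :
  set (set T) := <<s \bigcup_i events_of G (Z i) >>.

(* For possibly non-measurable Q this is a lower bound on the inner
   probability of Q; for measurable Q it says p <= P Q. *)
Definition with_prob_ge (p : R) (Q : T -> Prop) : Prop :=
  exists E : set T, [/\ measurable E, (p%:E <= P E)%E & forall w, E w -> Q w].

Definition sigma_xi (xi : T -> R) : R := Num.sqrt (mean (fun w => xi w ^+ 2)).

Section RandomMatrix.
Variables (m : nat) (X : T -> 'M[C]_m).

Definition L2norm (A : 'M[C]_m) : R :=
  Num.sqrt (mean (fun w => Normc.normc (hs_inner A (X w)) ^+ 2)).

Definition sigma_mx p (Z : T -> 'M[C]_p) : R :=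
  Num.sqrt (opnorm (mxmean (fun w =>
    (Z w - mxmean Z) *m (Z w - mxmean Z)))).

Definition sigma_X : R := sigma_mx X.

Definition sigma_XX : R := sigma_mx (fun w => X w *t X w).

Definition Gamma (eps : R) : R :=
  Num.max (m%:R * Num.sqrt (mean (fun w => opnorm (X w) ^+ 2)) / Num.sqrt eps)
          m%:R.

(* eps (||log S|| /\ log Gamma). The minimum is finite because log Gamma is,
   and the whole expression is 0 for eps = 0. *)
Definition entropy_term (eps : R) (S : 'M[C]_m) : R :=
  eps * fine (mine (norm_log S) (ln (Gamma eps))%:E).

End RandomMatrix.
End Probability.

Section Model.
Context {R : realType} {d : measure_display} {T : measurableType d}.
Variable P : probability T R.
Local Notation C := R[i].
Variables (m n : nat).

(* A generic copy [X0] followed by the sample [Xs]. *)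
Definition with_copy V (X0 : V) (Xs : 'I_n -> V) (o : option 'I_n) : V :=
  oapp Xs X0 o.

Record sampling_model (X : T -> 'M[C]_m) (Xs : 'I_n -> T -> 'M[C]_m)
    (xi : T -> R) (xis : 'I_n -> T -> R) : Prop := {
  model_herm : forall o w, with_copy X Xs o w \is hermsymmx ;
  model_mxrv : forall o, random_mx (with_copy X Xs o) ;
  model_rv : forall o, measurable_fun setT (with_copy xi xis o) ;
  model_iid_X : iid P (mx_borel m) (with_copy X Xs) ;
  model_iid_xi : iid P measurable (with_copy xi xis) ;
  model_indep : independent P
    (joint_events (mx_borel m) (with_copy X Xs))
    (joint_events measurable (with_copy xi xis)) ;
  model_mean : ('E_P[xi] = 0)%E ;
  model_var : ('E_P[fun w => (xi w ^+ 2)%R] < +oo)%E }.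

Definition response (rho : 'M[C]_m) (Xs : 'I_n -> T -> 'M[C]_m)
    (xis : 'I_n -> T -> R) (j : 'I_n) (w : T) : R :=
  complex.Re (\tr (rho *m Xs j w)) + xis j w.

Definition objective (Y : 'I_n -> R) (x : 'I_n -> 'M[C]_m) (eps : R)
    (S : 'M[C]_m) : R :=
  n%:R^-1 * (\sum_(j < n) (Y j - complex.Re (\tr (S *m x j))) ^+ 2)
  + eps * tr_xlogx S.

Definition is_argmin V (D : set V) (f : V -> R) (s : V) : Prop :=
  D s /\ forall s', D s' -> f s <= f s'.

Definition is_estimator (rho : 'M[C]_m) (Xs : 'I_n -> T -> 'M[C]_m)
    (xis : 'I_n -> T -> R) (eps : R) (rho_hat : T -> 'M[C]_m) : Prop :=
  forall w, is_argmin (@density R m)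
    (objective (fun j => response rho Xs xis j w) (fun j => Xs j w) eps)
    (rho_hat w).

End Model.

(* Main.v *)
Require Import Defs.
From HB Require Import structures.
From mathcomp Require Import all_boot all_order all_algebra.
From mathcomp Require Import complex mxtens zify ring lra.
From mathcomp Require Import all_classical all_reals all_analysis.
From mathcomp Require Import measurable_realfun.

Set Implicit Arguments.
Unset Strict Implicit.
Unset Printing Implicit Defensive.

Import Order.TTheory GRing.Theory Num.Theory.

Local Open Scope classical_set_scope.
Local Open Scope ring_scope.
Local Open Scope complex_scope.
Local Open Scope sesquilinear_scope.

Local Notation nc := Normc.normc.
Local Notation Re := complex.Re.
Local Notation Im := complex.Im.

(** The bound rests on two facts: at the estimator [r] the criterion satisfies a
    variational inequality, and two matrix averages concentrate.

    For the first, compare [r] with [(1 - s) r + s S] and let [s] tend to 0. The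
    quadratic part contributes its derivative. The entropy [tr (S log S)] is
    convex and lies between [- log m] and [0], so that the penalty contributes at
    most [eps log m] ([argmin_variational]). This is at most [entropy_term]:
    [Gamma >= m] by definition, and the smallest eigenvalue of a density matrix
    is at most [1 / m], hence [norm_log S >= log m] ([entropy_term_ge]). With
    [q A] the average of [<A, X_j> ^ 2], polarization gives
    [[
      q (r - rho) + q (r - S)
        <= q (S - rho) + 2 <r - S, average of xi_j X_j> + eps log m
    ]]
    ([estimator_basic_inequality]); keeping both squares on the left yields the
    constant 1 before [q (S - rho)] in both bounds of the theorem.

    For the second, [<A, X> ^ 2 = <A (x) A, X (x) X>], so that [q A] and
    [L2norm A ^ 2] differ by the pairing of [A (x) A] with the average of
    [X_j (x) X_j - E (X (x) X)]. Differences of density matrices have bounded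
    trace norm, and it suffices to bound the operator norms of this average, of
    dimension [m ^ 2], and of the average of [xi_j X_j]. Both are instances of
    [matrix_bernstein]; its logarithmic factors [log m] and [log (m ^ 2)] are
    absorbed in [t + log (2 m)].

    The matrix Bernstein inequality is proved by the Laplace transform method of
    Ahlswede and Winter, with [(1 + A / N) ^ N], [N] a power of 2, in place of
    the exponential. The trace of this power is a polynomial in the entries,
    whence measurability and integrability, and the Golden-Thompson inequality
    holds for it up to an error [O(1/N)] ([golden_thompson_approx]). This
    follows from [|tr (X ^ (2 h))| <= tr ((X X^* ) ^ h)] for [h] a power of 2
    ([tr_word_le]). Independence then gives
    [[
      E tr (1 + S_k / N) ^ N <= q E tr (1 + S_(k - 1) / N) ^ N + O(1/N)
    ]]
    for the partial sums [S_k] scaled by [th], with [q = 1 + 2 th ^ 2 v]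
    ([trpow_step]), and Markov's inequality for one
    large [N] concludes ([ev_psum_tail]). *)



(** * Adjoints and traces of complex matrices *)

Section Adjoint.
Context {R : realType}.
Local Notation C := R[i].

Lemma norm_nc (z : C) : `|z| = (nc z)%:C.
Proof. by rewrite normc_def; case: z. Qed.

Lemma nc_ge0 (z : C) : 0 <= nc z.
Proof. by case: z => a b; rewrite sqrtr_ge0. Qed.

Lemma nc_sum (I : Type) (r : seq I) (F : I -> C) :
  nc (\sum_(i <- r) F i) <= \sum_(i <- r) nc (F i).
Proof.
elim/big_ind2 : _ => [|x1 x2 y1 y2 h1 h2|//]; first by rewrite Normc.normc0.
by rewrite (le_trans (le_normcD _ _))// lerD.
Qed.

Lemma Re_le_nc (z : C) : `|Re z| <= nc z.
Proof. by have := normc_ge_Re z; rewrite norm_nc lecR. Qed.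

Lemma nc_real (x : R) : nc x%:C = `|x|.
Proof. by rewrite /= expr0n addr0 sqrtr_sqr. Qed.

Lemma Re_ge0 (z : C) : 0 <= z -> 0 <= Re z.
Proof. by rewrite lecE => /andP[]. Qed.

Lemma ReD (x y : C) : Re (x + y) = Re x + Re y.
Proof. by case: x; case: y. Qed.

Lemma ReN (x : C) : Re (- x) = - Re x.
Proof. by case: x. Qed.

Lemma ReB (x y : C) : Re (x - y) = Re x - Re y.
Proof. by rewrite ReD ReN. Qed.

Lemma Re_sum (I : Type) (r : seq I) (P : pred I) (F : I -> C) :
  Re (\sum_(i <- r | P i) F i) = \sum_(i <- r | P i) Re (F i).
Proof. by elim/big_rec2 : _ => [|i y x _ <-]; rewrite ?ReD. Qed.

Lemma ReZ (a : R) (z : C) : Re (a%:C * z) = a * Re z.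
Proof. by case: z => x y /=; rewrite mul0r subr0. Qed.

Lemma conjZ (a : R) : Num.conj a%:C = a%:C :> C.
Proof. by rewrite -[RHS]conjc_real. Qed.

Lemma adjM m n p (A : 'M[C]_(m, n)) (B : 'M[C]_(n, p)) :
  (A *m B)^t* = B^t* *m A^t*.
Proof. by rewrite trmx_mul map_mxM. Qed.

Lemma adjD m n (A B : 'M[C]_(m, n)) : (A + B)^t* = A^t* + B^t*.
Proof. by rewrite linearD /= map_mxD. Qed.

Lemma adjN m n (A : 'M[C]_(m, n)) : (- A)^t* = - A^t*.
Proof. by rewrite linearN /= map_mxN. Qed.

Lemma adjB m n (A B : 'M[C]_(m, n)) : (A - B)^t* = A^t* - B^t*.
Proof. by rewrite adjD adjN. Qed.

Lemma adjZ m n (a : R) (A : 'M[C]_(m, n)) : (a%:C *: A)^t* = a%:C *: A^t*.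
Proof. by rewrite linearZ /= map_mxZ /= conjZ. Qed.

Lemma adj1 m : (1%:M : 'M[C]_m)^t* = 1%:M.
Proof. by rewrite trmx1 map_mx1. Qed.

Lemma adjX m (A : 'M[C]_m) k : (A ^+ k)^t* = (A^t*) ^+ k.
Proof.
elim: k => [|k IH]; first by rewrite !expr0 adj1.
by rewrite exprSr exprS -[_ * A]/(_ *m A) adjM IH.
Qed.

Lemma tr_adj m (A : 'M[C]_m) : \tr (A^t*) = Num.conj (\tr A).
Proof. by rewrite -map_trmx mxtrace_tr rmorph_sum; apply: eq_bigr => i _; rewrite mxE. Qed.

Lemma hermP m (A : 'M[C]_m) : A \is hermsymmx <-> A^t* = A.
Proof.
split=> [/is_hermitianmxP|h]; first by rewrite expr0 scale1r.
by apply/is_hermitianmxP; rewrite expr0 scale1r.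
Qed.

Definition frob m n (A : 'M[C]_(m, n)) : R := Re (\tr (A *m A^t*)).

Lemma tr_mul_adj m n (A B : 'M[C]_(m, n)) :
  \tr (A *m B^t*) = \sum_i \sum_j A i j * Num.conj (B i j).
Proof.
by apply: eq_bigr => i _; rewrite !mxE; apply: eq_bigr => j _; rewrite !mxE.
Qed.

Lemma mulC_conj (z : C) : z * Num.conj z = (nc z ^+ 2)%:C.
Proof. by rewrite -normCK norm_nc rmorphXn. Qed.

Lemma frobE m n (A : 'M[C]_(m, n)) : frob A = \sum_i \sum_j nc (A i j) ^+ 2.
Proof.
rewrite /frob tr_mul_adj Re_sum; apply: eq_bigr => i _.
by rewrite Re_sum; apply: eq_bigr => j _; rewrite mulC_conj.
Qed.

Lemma tr_frob m n (A : 'M[C]_(m, n)) : \tr (A *m A^t*) = (frob A)%:C.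
Proof.
rewrite frobE tr_mul_adj rmorph_sum; apply: eq_bigr => i _.
by rewrite rmorph_sum; apply: eq_bigr => j _; rewrite mulC_conj.
Qed.

Lemma frob_ge0 m n (A : 'M[C]_(m, n)) : 0 <= frob A.
Proof.
by rewrite frobE; apply: sumr_ge0 => i _; apply: sumr_ge0 => j _; rewrite sqr_ge0.
Qed.

Lemma tr_CauchySchwarz m n (A B : 'M[C]_(m, n)) :
  nc (\tr (A *m B^t*)) ^+ 2 <= frob A * frob B.
Proof.
have e (U V : 'M[C]_(m, n)) : \tr (U *m V^t*) = dotmx (mxvec U) (mxvec V).
  rewrite tr_mul_adj dotmxE mxE pair_bigA /= (reindex _ (curry_mxvec_bij _ _)).
  by apply: eq_bigr => -[i j] _; rewrite !mxE /= !mxvecE.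
have : `|dotmx (mxvec A) (mxvec B)| ^+ 2 <=
    dotmx (mxvec A) (mxvec A) * dotmx (mxvec B) (mxvec B).
  by have [] := CauchySchwarz (@dotmx C _) (mxvec A) (mxvec B).
by rewrite -!e !tr_frob norm_nc -rmorphXn -rmorphM lecR.
Qed.

End Adjoint.

(** * A trace inequality for powers of a product *)

Section CyclicPower.
Context {R : realType} {m : nat}.

Lemma tr_expMC (A B : 'M[R[i]]_m) n : \tr ((A *m B) ^+ n) = \tr ((B *m A) ^+ n).
Proof.
case: n => [//|n].
have : B *m (A *m B) ^+ n = (B *m A) ^+ n *m B.
  elim: n => [|n IH]; first by rewrite !expr0 mul1mx mulmx1.
  rewrite exprSr -[_ * (_ *m _)]/(_ *m (_ *m _)) (mulmxA B) IH -mulmxA exprSr.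
  by rewrite -[_ * (_ *m _)]/(_ *m (_ *m _)) !mulmxA.
move=> e; rewrite exprS -[_ * _]/(_ *m _) -mulmxA e mxtrace_mulC exprSr.
by rewrite -mulmxA.
Qed.

End CyclicPower.

Section Words.
Context {R : realType} {m : nat}.
Local Notation C := R[i].
Variable X : 'M[C]_m.

Definition word (s : seq bool) : 'M[C]_m :=
  \prod_(b <- s) (if b then X else X^t*).

Definition adjw (s : seq bool) := rev (map negb s).

Definition altw (b : bool) n := mkseq (fun i => b (+) odd i) n.

Lemma word_cat s t : word (s ++ t) = word s *m word t.
Proof. by rewrite /word big_cat. Qed.

Lemma size_adjw s : size (adjw s) = size s.
Proof. by rewrite size_rev size_map. Qed.

Lemma word_adj s : word (adjw s) = (word s)^t*.
Proof.
elim: s => [|b s IH]; first by rewrite /word /adjw !big_nil adj1.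
rewrite /adjw map_cons rev_cons -cats1 word_cat -/(adjw s) IH.
rewrite -(cat1s b s) word_cat adjM; congr (_ *m _).
by rewrite /word !big_seq1; case: b => //=; rewrite trmxCK.
Qed.

Lemma tr_word_rot s t : \tr (word (s ++ t)) = \tr (word (t ++ s)).
Proof. by rewrite !word_cat mxtrace_mulC. Qed.

Lemma altw_adjw b n : altw b n ++ adjw (altw b n) = altw b (n + n)%N.
Proof.
have sz : size (altw b n ++ adjw (altw b n)) = (n + n)%N.
  by rewrite size_cat size_adjw size_mkseq.
apply: (@eq_from_nth _ false); first by rewrite sz size_mkseq.
rewrite sz => i lin; rewrite nth_mkseq// nth_cat size_mkseq.
case: ltnP => [lt_in|le_ni]; first by rewrite nth_mkseq.
have h : (i - n < n)%N by rewrite ltn_subLR.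
have h' : (n - (i - n).+1 < n)%N by move: h; clear; lia.
rewrite nth_rev size_map size_mkseq// (nth_map false) ?size_mkseq// nth_mkseq//.
rewrite oddB// oddS oddB// -addbN -addbN; congr (_ (+) _).
by case: (odd n) (odd i) => [] [].
Qed.

Lemma word_altw b k :
  nc (\tr (word (altw b (2 ^ k.+1)))) = Re (\tr ((X *m X^t*) ^+ (2 ^ k))).
Proof.
have E n : word (altw true (n + n)%N) = (X *m X^t*) ^+ n.
  elim: n => [|n IH]; first by rewrite /word big_nil.
  rewrite exprSr -IH addnS addSn /altw /word /mkseq -addn2 iotaD map_cat big_cat /=.
  by rewrite !big_cons big_nil add0n /= addnn odd_double /= mulr1.

have E' n : word (altw false (n + n)%N) = (X^t* *m X) ^+ n.
  elim: n => [|n IH]; first by rewrite /word big_nil.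
  rewrite exprSr -IH addnS addSn /altw /word /mkseq -addn2 iotaD map_cat big_cat /=.
  by rewrite !big_cons big_nil add0n /= addnn odd_double /= mulr1.
have pos : 0 <= \tr ((X *m X^t*) ^+ (2 ^ k)).
  have hX : (X *m X^t*)^t* = X *m X^t* by rewrite adjM trmxCK.
  case: k => [|k]; first by rewrite expr1 tr_frob ler0c frob_ge0.
  rewrite expnS mul2n -addnn exprD -{2}hX -adjX.
  by rewrite -[_ * _]/(_ *m _) tr_frob ler0c frob_ge0.
have -> : nc (\tr (word (altw b (2 ^ k.+1)))) = nc (\tr ((X *m X^t*) ^+ (2 ^ k))).
  by rewrite expnS mul2n -addnn; case: b; [rewrite E | rewrite E' (tr_expMC (X^t* ) X)].
by apply: complexI; rewrite -norm_nc (ger0_norm pos) RRe_real ?ger0_real.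
Qed.

(** Cut a word of maximal trace into two halves: Cauchy-Schwarz bounds it by the
    words [u u*] and [v v*] built from the halves, so that these are maximal
    too. If [u] ends with an alternating run, then this run is twice as long in
    [u u*]. Repeating this, the maximum is attained at the alternating word. *)
Lemma tr_word_le k s : size s = (2 ^ k.+1)%N ->
  nc (\tr (word s)) <= Re (\tr ((X *m X^t*) ^+ (2 ^ k))).
Proof.
move=> szs.
pose f (t : (2 ^ k.+1).-tuple bool) := nc (\tr (word t)).
have szs' : size s == (2 ^ k.+1)%N by rewrite szs.
pose t0 := [arg max_(t > (Tuple szs') | true) f t]%O.
have max (u : seq bool) : size u = (2 ^ k.+1)%N -> nc (\tr (word u)) <= f t0.
  move=> /eqP szu; rewrite /t0; case: arg_maxP => // t _ /(_ (Tuple szu) isT).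
  exact.
pose h := (2 ^ k)%N.
have hh : (h + h = 2 ^ k.+1)%N by rewrite addnn -mul2n -expnS.
(* Some word of maximal trace starts with an alternating run of length 2 ^ i. *)
have key i : (i <= k.+1)%N -> exists b r, size (altw b (2 ^ i) ++ r) = (2 ^ k.+1)%N
    /\ f t0 <= nc (\tr (word (altw b (2 ^ i) ++ r))).
  elim: i => [_|i IH lik].
    case E : (tval t0) => [|b r].
      by have := size_tuple t0; rewrite E => /esym/eqP; rewrite expn_eq0.
    exists b, r; have -> : altw b (2 ^ 0) ++ r = t0 by rewrite E /altw /mkseq /= addbF.
    by rewrite size_tuple.
  have [b [r [sz ge]]] := IH (ltnW lik).
  have lih : (2 ^ i <= h)%N by rewrite leq_exp2l.
  have szr : size r = (h + (h - 2 ^ i))%N.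
    move: sz; rewrite size_cat size_mkseq -hh => e.
    by rewrite addnBA// -e addKn.
  (* The word is rotated so that the run ends its first half u. *)
  pose v := take h r; pose w := drop h r.
  have szv : size v = h by rewrite size_take szr; case: ltngtP => //; lia.
  have szw : size w = (h - 2 ^ i)%N by rewrite size_drop szr addKn.
  pose u := w ++ altw b (2 ^ i).
  have szu : size u = h by rewrite size_cat szw size_mkseq subnK.
  have e : \tr (word (altw b (2 ^ i) ++ r)) = \tr (word u *m (word (adjw v))^t*).
    rewrite -word_adj /adjw map_rev revK -map_comp map_id_in ?rev_involutive; last first.
      by move=> x _ /=; rewrite negbK.
    by rewrite -word_cat -(cat_take_drop h r) catA tr_word_rot /u -/v -/w catA.
  have cs := tr_CauchySchwarz (word u) (word (adjw v)); rewrite -e in cs.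
  have fv : frob (word (adjw v)) <= f t0.
    rewrite /frob -word_adj -word_cat.
    apply: le_trans (le_trans (ler_norm _) (Re_le_nc _)) (max _ _).
    by rewrite size_cat !size_adjw szv hh.
  have fu : frob (word u) <= nc (\tr (word (altw b (2 ^ i.+1) ++ (adjw w ++ w)))).
    have -> : \tr (word (altw b (2 ^ i.+1) ++ (adjw w ++ w))) = \tr (word (u ++ adjw u)).
      rewrite /u /adjw map_cat rev_cat -!/(adjw _) -!catA [in RHS]tr_word_rot.
      by rewrite expnS mul2n -addnn -altw_adjw -!catA.
    rewrite /frob -word_adj -word_cat.
    exact: le_trans (ler_norm _) (Re_le_nc _).
  exists b, (adjw w ++ w); split.
    rewrite !size_cat size_adjw szw size_mkseq -hh expnS.
    by move: lih; clear; lia.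
  have [f0|f0] := leP (f t0) 0; first by rewrite (le_trans f0) ?nc_ge0.
  rewrite -(ler_pM2r f0); apply: le_trans (ler_pM _ _ fu fv); rewrite ?frob_ge0//.
  by apply: le_trans cs; rewrite -expr2 lerXn2r ?nnegrE ?nc_ge0.
have [b [r [sz ge]]] := key k.+1 (leqnn _).
have r0 : r = [::].
  apply/eqP; rewrite -size_eq0; move: sz; rewrite size_cat size_mkseq => /eqP.
  by rewrite -[X in _ == X]addn0 eqn_add2l.
by rewrite r0 cats0 word_altw in ge; apply: le_trans ge; exact: max.
Qed.

End Words.

(** * A Golden-Thompson inequality for finite powers *)

Section GoldenThompson.
Context {R : realType} {m : nat}.
Local Notation C := R[i].
Implicit Types A B P Q : 'M[C]_m.

(** [tr_word_le] applied to [A B] bounds the trace by that of [(A B^2 A) ^ (2 ^ k)],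
    hence of [(A^2 B^2) ^ (2 ^ k)]: half the exponent, for the squares. *)
Lemma tr_expM_le A B k : A^t* = A -> B^t* = B ->
  nc (\tr ((A *m B) ^+ (2 ^ k.+1))) <=
  Re (\tr (A ^+ (2 ^ k.+1) *m B ^+ (2 ^ k.+1))).
Proof.
have powerword (X : 'M[C]_m) n : X ^+ n = word X (nseq n true).
  by rewrite /word big_nseq; elim: n => [//|n IH]; rewrite exprS IH.
elim: k A B => [|k IH] A B hA hB; rewrite powerword;
  apply: le_trans (tr_word_le _ (size_nseq _ _)) _;
  rewrite adjM hA hB -!mulmxA (tr_expMC A (B *m (B *m A))) -!mulmxA (mulmxA B B)
    -[A *m A]/(A ^+ 2) -[B *m B]/(B ^+ 2).
  by rewrite expn0 expn1 expr1 (mxtrace_mulC (B ^+ 2)) !mulmxA.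
apply: le_trans (le_trans (ler_norm _) (Re_le_nc _)) _.
apply: le_trans (IH (B ^+ 2) (A ^+ 2) _ _) _; rewrite ?adjX ?hA ?hB//.
by rewrite mxtrace_mulC [in X in _ <= X]expnS !exprM.
Qed.

(** The maximal absolute row sum is a submultiplicative norm in which the
    identity has norm one, so that [(1 + A / N) ^ N] is bounded in [N]. *)
Definition rowbd A (c : R) := forall i, \sum_j nc (A i j) <= c.

Lemma rowbdD A B a b : rowbd A a -> rowbd B b -> rowbd (A + B) (a + b).
Proof.
move=> hA hB i; apply: le_trans (lerD (hA i) (hB i)).
by rewrite -big_split; apply: ler_sum => j _; rewrite mxE le_normcD.
Qed.

Lemma rowbdZ A a (c : R) : rowbd A a -> rowbd (c%:C *: A) (`|c| * a).
Proof.
move=> hA i; apply: le_trans (ler_wpM2l (normr_ge0 c) (hA i)).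
by rewrite mulr_sumr; apply: ler_sum => j _; rewrite mxE Normc.normcM nc_real.
Qed.

Lemma rowbdM A B a b : rowbd A a -> rowbd B b -> rowbd (A *m B) (a * b).
Proof.
move=> hA hB i.
have b0 : 0 <= b by apply: le_trans (hB i); apply: sumr_ge0 => j _; exact: nc_ge0.
apply: (@le_trans _ _ (\sum_k nc (A i k) * b)); last first.
  by rewrite -mulr_suml ler_wpM2r.
apply: (@le_trans _ _ (\sum_j \sum_k nc (A i k) * nc (B k j))).
  apply: ler_sum => j _; rewrite mxE; apply: le_trans (nc_sum _ _) _.
  by apply: ler_sum => k _; rewrite Normc.normcM.
rewrite exchange_big; apply: ler_sum => k _.
by rewrite -mulr_sumr ler_wpM2l ?nc_ge0.
Qed.

Lemma rowbd1 : rowbd 1%:M 1.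
Proof.
move=> i; rewrite (bigD1 i)//= mxE eqxx mulr1n Normc.normc1 big1 ?addr0// => j ji.
by rewrite mxE eq_sym (negPf ji) Normc.normc0.
Qed.

Lemma rowbdW A a b : a <= b -> rowbd A a -> rowbd A b.
Proof. by move=> ab hA i; exact: le_trans (hA i) ab. Qed.

Lemma rowbdX A a k : rowbd A a -> rowbd (A ^+ k) (a ^+ k).
Proof.
move=> hA; elim: k => [|k IH]; first by rewrite !expr0; exact: rowbd1.
by rewrite !exprSr; exact: rowbdM.
Qed.

Lemma nc_entry_le A a i j : rowbd A a -> nc (A i j) <= a.
Proof.
move=> /(_ i); apply: le_trans; rewrite (bigD1 j)//= lerDl.
by apply: sumr_ge0 => k _; exact: nc_ge0.
Qed.

Lemma nc_tr_le A a : rowbd A a -> nc (\tr A) <= m%:R * a.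
Proof.
move=> hA; apply: le_trans (nc_sum _ _) _.
apply: (@le_trans _ _ (\sum_(i < m) a)).
  by apply: ler_sum => i _; exact: nc_entry_le.
by rewrite sumr_const card_ord mulr_natl.
Qed.

Lemma rowbd_subX P Q r e N : 0 <= r -> rowbd P r -> rowbd Q r -> rowbd (P - Q) e ->
  rowbd (P ^+ N - Q ^+ N) (N%:R * (r ^+ N.-1 * e)).
Proof.
move=> r0 hP hQ hPQ; elim: N => [|N IH].
  move=> i; rewrite mul0r subrr big1// => j _; by rewrite mxE Normc.normc0.
have -> : P ^+ N.+1 - Q ^+ N.+1 = P ^+ N *m (P - Q) + (P ^+ N - Q ^+ N) *m Q.
  rewrite mulmxBr mulmxBl !exprSr -![_ * _]/(_ *m _).
  by rewrite addrA subrK.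
rewrite -natr1 mulrDl mul1r addrC; apply: rowbdD; last first.
  by apply: rowbdM => //; exact: rowbdX.
case: N IH => [|N] IH.
  by rewrite mul0r !expr0 subrr mul0mx => i; rewrite big1// => j _; rewrite mxE Normc.normc0.
apply: rowbdW (rowbdM IH hQ); rewrite le_eqVlt; apply/orP; left; apply/eqP.
by rewrite /= exprS; ring.
Qed.

Lemma adj_affine (c : R) A : A^t* = A -> (1%:M + c%:C *: A)^t* = 1%:M + c%:C *: A.
Proof. by move=> hA; rewrite adjD adj1 adjZ hA. Qed.

Lemma rowbd_affine (c : R) A a : 0 <= c -> rowbd A a ->
  rowbd (1%:M + c%:C *: A) (1 + c * a).
Proof.
move=> c0 hA; apply: rowbdD; first exact: rowbd1.
by rewrite -{2}(ger0_norm c0); exact: rowbdZ.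
Qed.

(** With [(1 + A / N) ^ N] in place of the exponential, the Golden-Thompson
    inequality holds up to [O(1/N)]: the factors [1 + (A + B) / N] and
    [(1 + A / N) (1 + B / N)] differ by [A B / N ^ 2], so that their [N]-th
    powers differ by [O(1/N)]. *)
Lemma golden_thompson_approx A B a b k (N := (2 ^ k.+1)%N) (c := N%:R^-1 : R) :
  0 <= a -> 0 <= b -> A^t* = A -> B^t* = B -> rowbd A a -> rowbd B b ->
  Re (\tr ((1%:M + c%:C *: (A + B)) ^+ N)) <=
  Re (\tr ((1%:M + c%:C *: A) ^+ N *m (1%:M + c%:C *: B) ^+ N)) +
  m%:R * (expR (a + b) * (a * b) / N%:R).
Proof.
move=> a0 b0 hA hB bA bB.
have N0 : 0 < N%:R :> R by rewrite ltr0n expn_gt0.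
have c0 : 0 <= c by rewrite invr_ge0 ltW.
pose P := 1%:M + c%:C *: (A + B).
pose Q := (1%:M + c%:C *: A) *m (1%:M + c%:C *: B).
have eQ : Q = P + (c ^+ 2)%:C *: (A *m B).
  rewrite /Q /P mulmxDl mul1mx mulmxDr mulmx1 -scalemxAl -scalemxAr scalerA.
  by rewrite rmorphXn /= expr2 scalerDr !addrA (addrAC 1%:M).
pose r := (1 + c * a) * (1 + c * b).
have r1 : 1 <= r.
  by rewrite -[1]mulr1 ler_pM// lerDl mulr_ge0.
have bP : rowbd P r.
  have := rowbd_affine c0 (rowbdD bA bB); apply: rowbdW.
  have : 0 <= c * a * (c * b) by rewrite !mulr_ge0.
  by rewrite /r; nra.
have bQ : rowbd Q r by apply: rowbdM; exact: rowbd_affine.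
have bPQ : rowbd (P - Q) (c ^+ 2 * (a * b)).
  have -> : P - Q = (- c ^+ 2)%:C *: (A *m B).
    by rewrite eQ opprD addrA subrr sub0r -scaleNr rmorphN.
  have e : `|- c ^+ 2| = c ^+ 2 by rewrite normrN ger0_norm// exprn_ge0.
  by have := rowbdZ (- c ^+ 2) (rowbdM bA bB); rewrite e.
have := nc_tr_le (rowbd_subX N (le_trans ler01 r1) bP bQ bPQ).
rewrite raddfB /= => /(le_trans (Re_le_nc _)) /(le_trans (ler_norm _)).
rewrite ReB lerBlDl => /le_trans -> //; apply: lerD.
  apply: le_trans (tr_expM_le _ _ _) => //; try exact: adj_affine.
  exact: le_trans (ler_norm _) (Re_le_nc _).
rewrite ler_wpM2l//.
have rN : r ^+ N <= expR (a + b).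
  have h x : 0 <= x -> (1 + c * x) ^+ N <= expR x.
    move=> x0; have -> : expR x = expR (c * x) ^+ N.
      by rewrite -expRM_natl mulrA mulfV ?mul1r// gt_eqF.
    by rewrite lerXn2r ?expR_ge1Dx// nnegrE ?expR_ge0// addr_ge0// mulr_ge0.
  by rewrite /r exprMn expRD ler_pM ?h// exprn_ge0// addr_ge0 ?mulr_ge0.
have rN1 : r ^+ N.-1 <= expR (a + b).
  by apply: le_trans rN; rewrite ler_weXn2l// leq_pred.
have -> : N%:R * (r ^+ N.-1 * (c ^+ 2 * (a * b))) = r ^+ N.-1 * (a * b) / N%:R.
  by rewrite /c; field; rewrite gt_eqF.
by rewrite ler_pM2r ?invr_gt0// ler_wpM2r ?mulr_ge0.
Qed.

End GoldenThompson.

(** * Positive semidefinite matrices and functional calculus *)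

Section Psd.
Context {R : realType}.
Local Notation C := R[i].

Lemma quad_sqnorm m (x : 'cV[C]_m) : (x^t* *m x) 0 0 = (vec_norm x ^+ 2)%:C.
Proof.
rewrite sqr_sqrtr; last by apply: sumr_ge0 => i _; rewrite sqr_ge0.
rewrite mxE rmorph_sum; apply: eq_bigr => i _.
by rewrite !mxE mulrC mulC_conj.
Qed.

Lemma psd_congr m n (A : 'M[C]_m) (B : 'M[C]_(m, n)) : psd A -> psd (B^t* *m A *m B).
Proof. by move=> hA x; have := hA (B *m x); rewrite adjM !mulmxA. Qed.

Lemma psd1 m : psd (1%:M : 'M[C]_m).
Proof. by move=> x; rewrite mulmx1 quad_sqnorm ler0c sqr_ge0. Qed.

Lemma psd_adjM m n (B : 'M[C]_(m, n)) : psd (B^t* *m B).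
Proof. by have := psd_congr B (@psd1 m); rewrite mulmx1. Qed.

Lemma psdD m (A B : 'M[C]_m) : psd A -> psd B -> psd (A + B).
Proof. by move=> hA hB x; rewrite mulmxDr mulmxDl mxE addr_ge0. Qed.

Lemma psdZ m (c : R) (A : 'M[C]_m) : 0 <= c -> psd A -> psd (c%:C *: A).
Proof. by move=> c0 hA x; rewrite -scalemxAr -scalemxAl mxE mulr_ge0// ler0c. Qed.

Lemma adj_delta m n (i : 'I_m) (j : 'I_n) : (delta_mx i j)^t* = delta_mx j i :> 'M[C]_(n, m).
Proof. by rewrite trmx_delta map_delta_mx. Qed.

Lemma psd_tr_ge0 m (A : 'M[C]_m) : psd A -> 0 <= Re (\tr A).
Proof.
move=> hA; rewrite Re_sum; apply: sumr_ge0 => i _.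
have := Re_ge0 (hA (delta_mx i 0)).
by rewrite adj_delta -rowE -colE !mxE.
Qed.

(** The real eigenvalues, indexed as the rows of [spectralmx]; the functional
    calculus [mxfun] applies a function to them. *)
Definition ev m (A : 'M[C]_m) (i : 'I_m) : R := Re (spectral_diag A 0 i).

Lemma mxfunE m f (A : 'M[C]_m) :
  mxfun f A = (spectralmx A)^t* *m diag_mx (\row_i (f (ev A i))%:C) *m spectralmx A.
Proof.
rewrite /mxfun invmx_unitary ?spectral_unitarymx//; congr (_ *m diag_mx _ *m _).
by apply/rowP => i; rewrite !mxE.
Qed.

Lemma spectralK m (A : 'M[C]_m) : (spectralmx A)^t* *m spectralmx A = 1%:M.
Proof.
by rewrite -invmx_unitary ?spectral_unitarymx// mulVmx// spectral_unit.
Qed.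

Lemma spectralVK m (A : 'M[C]_m) : spectralmx A *m (spectralmx A)^t* = 1%:M.
Proof. exact/unitarymxP/spectral_unitarymx. Qed.

Lemma eq_mxfun m f g (A : 'M[C]_m) : (forall i, f (ev A i) = g (ev A i)) ->
  mxfun f A = mxfun g A.
Proof.
by move=> fg; rewrite !mxfunE; congr (_ *m diag_mx _ *m _); apply/rowP => i; rewrite !mxE fg.
Qed.

Lemma mxfun_id m (A : 'M[C]_m) : A^t* = A -> mxfun idfun A = A.
Proof.
move=> /hermP hA; have /mxOverP sr := hermitian_spectral_diag_real hA.
have /hermitian_normalmx/orthomx_spectralP {2}-> := hA.
rewrite /mxfun; congr (_ *m diag_mx _ *m _); apply/rowP => i; rewrite !mxE.
by rewrite RRe_real.
Qed.

Lemma mxfun_cst m (c : R) (A : 'M[C]_m) : mxfun (fun=> c) A = c%:C%:M.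
Proof.
rewrite mxfunE (_ : diag_mx _ = c%:C%:M); last by rewrite -diag_const_mx; congr diag_mx; apply/rowP => i; rewrite !mxE.
by rewrite mul_mx_scalar -scalemxAl spectralK scalemx1.
Qed.

Lemma mxfunD m f g (A : 'M[C]_m) : mxfun (fun x => f x + g x) A = mxfun f A + mxfun g A.
Proof.
rewrite !mxfunE -mulmxDl -mulmxDr -raddfD /=; congr (_ *m diag_mx _ *m _).
by apply/rowP => i; rewrite !mxE rmorphD.
Qed.

Lemma mxfunM m f g (A : 'M[C]_m) : mxfun (fun x => f x * g x) A = mxfun f A *m mxfun g A.
Proof.
rewrite !mxfunE !mulmxA -(mulmxA _ (spectralmx A)) spectralVK mulmx1.
rewrite -(mulmxA _ (diag_mx _) (diag_mx _)) mulmx_diag; congr (_ *m diag_mx _ *m _).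
by apply/rowP => i; rewrite !mxE rmorphM.
Qed.

Lemma mxfunZ m c f (A : 'M[C]_m) : mxfun (fun x => c * f x) A = c%:C *: mxfun f A.
Proof. by rewrite mxfunM mxfun_cst mul_scalar_mx. Qed.

Lemma mxfunX m f (A : 'M[C]_m) k : mxfun (fun x => f x ^+ k) A = mxfun f A ^+ k.
Proof.
elim: k => [|k IH]; first by rewrite (@eq_mxfun _ _ (fun=> 1))// mxfun_cst.
by rewrite exprS -IH -[RHS]/(_ *m _) -mxfunM; apply: eq_mxfun => i; rewrite exprS.
Qed.

Lemma mxfun_adj m f (A : 'M[C]_m) : (mxfun f A)^t* = mxfun f A.
Proof.
rewrite mxfunE !adjM trmxCK mulmxA; congr (_ *m _ *m _).
rewrite tr_diag_mx map_diag_mx; congr diag_mx.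
by apply/rowP => i; rewrite !mxE; exact: conjZ.
Qed.

Lemma tr_mxfun m f (A : 'M[C]_m) : \tr (mxfun f A) = (\sum_i f (ev A i))%:C.
Proof.
rewrite mxfunE mxtrace_mulC mulmxA spectralVK mul1mx mxtrace_diag rmorph_sum.
by apply: eq_bigr => i _; rewrite mxE.
Qed.

Lemma tr_ev m (A : 'M[C]_m) : A^t* = A -> \tr A = (\sum_i ev A i)%:C.
Proof. by move=> hA; rewrite -[in LHS](mxfun_id hA) tr_mxfun. Qed.

Definition eigvec m (A : 'M[C]_m) i : 'cV[C]_m := col i ((spectralmx A)^t* ).

Lemma mxfun_eigvec m f (A : 'M[C]_m) i :
  mxfun f A *m eigvec A i = (f (ev A i))%:C *: eigvec A i.
Proof.
rewrite /eigvec mxfunE colE !mulmxA -(mulmxA _ (spectralmx A)) spectralVK mulmx1.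
rewrite -mulmxA [in RHS]scalemxAr; congr (_ *m _); apply/colP => j.
rewrite -colE !mxE; case: eqVneq => [->|ji]; first by rewrite mulr1n mulr1.
by rewrite mulr0n mulr0.
Qed.

Lemma eigvec_norm m (A : 'M[C]_m) i : ((eigvec A i)^t* *m eigvec A i) 0 0 = 1.
Proof.
rewrite /eigvec colE adjM trmxCK -mulmxA (mulmxA (spectralmx A)) spectralVK mul1mx.
by rewrite adj_delta -rowE !mxE !eqxx.
Qed.

Lemma vec_norm_eigvec m (A : 'M[C]_m) i : vec_norm (eigvec A i) = 1.
Proof.
have := eigvec_norm A i; rewrite quad_sqnorm => /complexI/eqP.
by rewrite sqrp_eq1 ?sqrtr_ge0// => /eqP.
Qed.

Lemma quad_eigvec m f (A : 'M[C]_m) i :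
  ((eigvec A i)^t* *m mxfun f A *m eigvec A i) 0 0 = (f (ev A i))%:C.
Proof. by rewrite -mulmxA mxfun_eigvec -scalemxAr mxE eigvec_norm mulr1. Qed.

Lemma tr_eigvec m (A B : 'M[C]_m) :
  \tr B = \sum_i ((eigvec A i)^t* *m B *m eigvec A i) 0 0.
Proof.
rewrite -[in LHS](mulmx1 B) -(spectralK A) mulmxA mxtrace_mulC mulmxA.
apply: eq_bigr => i _.
rewrite /eigvec colE adjM trmxCK adj_delta -!mulmxA -rowE !mulmxA.
by rewrite -colE [in RHS]mxE [in RHS]mxE.
Qed.

Lemma psd_mxfunP m f (A : 'M[C]_m) : psd (mxfun f A) <-> forall i, 0 <= f (ev A i).
Proof.
split=> [h i|h]; first by have := h (eigvec A i); rewrite quad_eigvec ler0c.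
rewrite mxfunE; apply: psd_congr => x.
rewrite -mulmxA mxE; apply: sumr_ge0 => i _.
rewrite mul_diag_mx !mxE mulrCA mulr_ge0 ?ler0c// mulrC mulC_conj ler0c sqr_ge0.
by [].
Qed.

Lemma psd_ev m (A : 'M[C]_m) : A^t* = A -> psd A <-> forall i, 0 <= ev A i.
Proof. by move=> hA; rewrite -{1}(mxfun_id hA) psd_mxfunP. Qed.

Lemma psd_sqrt m (A : 'M[C]_m) : A^t* = A -> psd A ->
  exists2 B : 'M[C]_m, B^t* = B & A = B *m B.
Proof.
move=> hA /(psd_ev hA) A0; exists (mxfun Num.sqrt A); first exact: mxfun_adj.
rewrite -mxfunM -[LHS](mxfun_id hA); apply: eq_mxfun => i.
by rewrite -expr2 sqr_sqrtr.
Qed.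

Lemma tr_mul_psd_ge0 m (A B : 'M[C]_m) : A^t* = A -> psd A -> psd B ->
  0 <= Re (\tr (A *m B)).
Proof.
move=> hA pA pB; have [S hS ->] := psd_sqrt hA pA.
by rewrite -mulmxA mxtrace_mulC -{1}hS; apply/psd_tr_ge0/psd_congr.
Qed.

(** ** Two-sided bounds *)

(** For a self-adjoint matrix this is a bound on the operator norm; unlike the
    latter, it passes to expectations at once. *)
Definition mxbound m (V : R) (A : 'M[C]_m) := psd (V%:C%:M - A) /\ psd (V%:C%:M + A).

Lemma mxboundP m V (A : 'M[C]_m) : A^t* = A ->
  mxbound V A <-> forall i, `|ev A i| <= V.
Proof.
move=> hA; rewrite /mxbound -[in X in X <-> _](mxfun_id hA).
have -> : V%:C%:M - mxfun idfun A = mxfun (fun x => V + -1 * x) A.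
  by rewrite mxfunD mxfun_cst mxfunZ rmorphN1 scaleN1r.
have -> : V%:C%:M + mxfun idfun A = mxfun (fun x => V + x) A.
  by rewrite mxfunD mxfun_cst.
rewrite !psd_mxfunP; split=> [[h1 h2] i|h].
  by rewrite ler_norml; have := h1 i; have := h2 i; lra.
by split=> i; have := h i; rewrite ler_norml; lra.
Qed.

Lemma mxtraceN m (A : 'M[C]_m) : \tr (- A) = - \tr A.
Proof. exact: raddfN. Qed.

Lemma tr_psd_mxbound m V (A B : 'M[C]_m) : A^t* = A -> psd A -> mxbound V B ->
  `|Re (\tr (A *m B))| <= V * Re (\tr A).
Proof.
move=> hA pA [h1 h2]; rewrite ler_norml.
have := tr_mul_psd_ge0 hA pA h1; have := tr_mul_psd_ge0 hA pA h2.
rewrite mulmxBr mulmxDr mul_mx_scalar !mxtraceD mxtraceZ mxtraceN ReB ReD ReZ.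
by lra.
Qed.

Lemma vec_norm_entry m (x : 'cV[C]_m) i : nc (x i 0) <= vec_norm x.
Proof.
rewrite -(ler_pXn2r (ltn0Sn 1)) ?nnegrE ?nc_ge0 ?sqrtr_ge0// sqr_sqrtr.
  by rewrite (bigD1 i)//= lerDl sumr_ge0// => j _; rewrite sqr_ge0.
by apply: sumr_ge0 => j _; rewrite sqr_ge0.
Qed.

Lemma vec_normZ m (c : R) (x : 'cV[C]_m) : vec_norm (c%:C *: x) = `|c| * vec_norm x.
Proof.
rewrite /vec_norm -sqrtr_sqr -sqrtrM ?sqr_ge0//; congr Num.sqrt.
rewrite mulr_sumr; apply: eq_bigr => i _.
by rewrite mxE Normc.normcM nc_real exprMn real_normK ?num_real.
Qed.

Lemma opnorm_ge m (A : 'M[C]_m) x : vec_norm x <= 1 -> vec_norm (A *m x) <= opnorm A.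
Proof.
move=> x1; apply: ub_le_sup; last by exists x.
exists (Num.sqrt (\sum_i (\sum_j nc (A i j)) ^+ 2)) => _ [y /= y1 <-].
rewrite ler_wsqrtr//; apply: ler_sum => i _.
rewrite lerXn2r ?nnegrE ?nc_ge0//; first by apply: sumr_ge0 => j _; exact: nc_ge0.
rewrite mxE; apply: le_trans (nc_sum _ _) _; apply: ler_sum => j _.
rewrite Normc.normcM ler_piMr ?nc_ge0//.
exact: le_trans (vec_norm_entry _ _) y1.
Qed.

Lemma opnorm_ge0 m (A : 'M[C]_m) : 0 <= opnorm A.
Proof.
have n0 : vec_norm (0 : 'cV[C]_m) <= 1.
  rewrite /vec_norm big1 ?sqrtr0// => i _; by rewrite mxE Normc.normc0 expr0n.
by apply: le_trans (opnorm_ge A n0); rewrite sqrtr_ge0.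
Qed.

Lemma ev_mxfun_opnorm m f (A : 'M[C]_m) i : `|f (ev A i)| <= opnorm (mxfun f A).
Proof.
have /(opnorm_ge (mxfun f A)) : vec_norm (eigvec A i) <= 1 by rewrite vec_norm_eigvec.
by rewrite mxfun_eigvec vec_normZ vec_norm_eigvec mulr1.
Qed.

Lemma opnorm_mxbound m (A : 'M[C]_m) : A^t* = A -> mxbound (opnorm A) A.
Proof.
move=> hA; apply/(mxboundP _ hA) => i.
by have := ev_mxfun_opnorm idfun A i; rewrite mxfun_id.
Qed.

End Psd.

(** * Powers of affine functions of a Hermitian matrix *)

Section AffinePowers.
Context {R : realType} {m : nat}.
Local Notation C := R[i].
Implicit Types A : 'M[C]_m.

Lemma affine_powE A (c : R) N : A^t* = A ->
  (1%:M + c%:C *: A) ^+ N = mxfun (fun x => (1 + c * x) ^+ N) A.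
Proof.
by move=> hA; rewrite mxfunX mxfunD mxfun_cst mxfunZ mxfun_id.
Qed.

Lemma affine_pow_adj A (c : R) N : A^t* = A ->
  ((1%:M + c%:C *: A) ^+ N)^t* = (1%:M + c%:C *: A) ^+ N.
Proof. by move=> hA; rewrite affine_powE// mxfun_adj. Qed.

Lemma psd_affine_pow A (c : R) N : A^t* = A -> ~~ odd N ->
  psd ((1%:M + c%:C *: A) ^+ N).
Proof.
by move=> hA oN; rewrite affine_powE//; apply/psd_mxfunP => i; rewrite exprn_even_ge0.
Qed.

(** All the eigenvalues of an even power are nonnegative, so that its trace
    dominates each of them. *)
Lemma ev_le_affine_pow A (c s : R) N : A^t* = A -> ~~ odd N -> (0 < N)%N ->
  0 < c -> 0 <= s ->
  Re (\tr ((1%:M + c%:C *: A) ^+ N)) <= (1 + c * s) ^+ N ->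
  forall i, ev A i <= s.
Proof.
move=> hA oN N0 c0 s0; rewrite affine_powE// tr_mxfun /= => h i.
have cs : 0 <= 1 + c * s by rewrite addr_ge0// mulr_ge0// ltW.
have : (1 + c * ev A i) ^+ N <= (1 + c * s) ^+ N.
  apply: le_trans h; rewrite (bigD1 i)//= lerDl sumr_ge0// => j _.
  by rewrite exprn_even_ge0.
have [x0|x0] := leP 0 (1 + c * ev A i).
  by rewrite ler_pXn2r ?nnegrE// lerD2l ler_pM2l.
move=> _; have : c * ev A i < 0 by lra.
by rewrite pmulr_rlt0// => /ltW /le_trans; exact.
Qed.

(** The scalar inequality [(1 + x / N) ^ N <= exp x <= 1 / (1 - x) <= 1 + x + 2 x ^ 2]
    for [x <= 1 / 2]. *)
Lemma affine_pow_le_quadratic A N (c := N%:R^-1 : R) : A^t* = A -> (0 < N)%N ->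
  (forall i, `|ev A i| <= 2^-1) ->
  psd (1%:M + A + 2%:C *: (A *m A) - (1%:M + c%:C *: A) ^+ N).
Proof.
move=> hA N0 h.
have -> : 1%:M + A + 2%:C *: (A *m A) - (1%:M + c%:C *: A) ^+ N =
    mxfun (fun x => 1 + x + 2 * (x * x) + -1 * (1 + c * x) ^+ N) A.
  rewrite !mxfunD mxfun_cst !mxfunZ mxfunM (mxfun_id hA) affine_powE//.
  by rewrite rmorphN1 scaleN1r.
apply/psd_mxfunP => i; set x := ev A i; have := h i; rewrite -/x ler_norml => /andP[x1 x2].
have N0' : 0 < N%:R :> R by rewrite ltr0n.
have c0 : 0 < c by rewrite invr_gt0.
have c1 : c <= 1 by rewrite invf_le1// ler1n.
have e1 : (1 + c * x) ^+ N <= expR x.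
  have -> : expR x = expR (c * x) ^+ N.
    by rewrite -expRM_natl mulrA mulfV ?mul1r// gt_eqF.
  rewrite lerXn2r ?expR_ge1Dx// nnegrE ?expR_ge0//.
  by have : c * - x <= 1 * - x \/ c * x >= 0; [have [x0|x0] := leP 0 x; [right|left]; nra|case; nra].
have e2 : expR x * (1 - x) <= 1.
  rewrite -[leRHS](expR0) -(subrr x) expRD ler_pM2l ?expR_gt0//.
  exact: expR_ge1Dx.
have e0 := expR_ge0 x.
suff : expR x <= 1 + x + 2 * (x * x) by lra.
rewrite -(@ler_pM2r _ (1 - x)); last lra.
apply: le_trans e2 _; nra.
Qed.

Lemma tr_exprE A k : A^t* = A -> Re (\tr (A ^+ k)) = \sum_i ev A i ^+ k.
Proof. by move=> hA; rewrite -[in LHS](mxfun_id hA) -mxfunX tr_mxfun. Qed.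

(** The trace powers turn a bound on the spectrum into countably many
    polynomial inequalities in the entries. *)
Lemma ev_norm_le_trP A U : A^t* = A -> 0 < U ->
  (forall i, `|ev A i| <= U) <->
  (forall k, Re (\tr (A ^+ k.*2)) <= m%:R * U ^+ k.*2).
Proof.
move=> hA U0; split=> [h k|h i].
  have -> : m%:R * U ^+ k.*2 = \sum_(i < m) U ^+ k.*2.
    by rewrite sumr_const card_ord mulr_natl.
  rewrite tr_exprE//; apply: ler_sum => i _.
  by rewrite -[ev A i ^+ _]ger0_norm ?exprn_even_ge0 ?odd_double// normrX lerXn2r ?nnegrE// ltW.
rewrite leNgt; apply/negP => lt.
(* Otherwise the powers of r are bounded by m although r > 1. *)
pose r := `|ev A i| / U; have r1 : 1 < r by rewrite ltr_pdivlMr// mul1r.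
have hk k : k.*2%:R * (r - 1) <= m%:R :> R.
  apply: (@le_trans _ _ (r ^+ k.*2)); last first.
    rewrite expr_div_n ler_pdivrMr ?exprn_gt0//; apply: le_trans (h k).
    rewrite tr_exprE// (bigD1 i)//= -normrX ger0_norm ?exprn_even_ge0 ?odd_double//.
    by rewrite lerDl sumr_ge0// => j _; rewrite exprn_even_ge0 ?odd_double.
  elim: (k.*2) => [|n IH]; first by rewrite mul0r expr0.
  rewrite exprS -natr1 mulrDl mul1r.
  have rn : 1 <= r ^+ n by rewrite exprn_ege1// ltW.
  nra.
have := hk (Num.trunc (m%:R / (r - 1))).+1.
have : m%:R / (r - 1) < (Num.trunc (m%:R / (r - 1))).+1%:R.
  by rewrite truncnS_gt.
rewrite ltr_pdivrMr ?subr_gt0// => l1 l2.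
have : (Num.trunc (m%:R / (r - 1))).+1%:R * (r - 1) <=
   (Num.trunc (m%:R / (r - 1))).+1.*2%:R * (r - 1).
  by rewrite ler_pM2r ?subr_gt0// ler_nat -addnn leq_addr.
by move: l1 l2; lra.
Qed.

End AffinePowers.

(** * Density matrices and entropy *)

Section Density.
Context {R : realType}.
Local Notation C := R[i].

Lemma density_adj m (S : 'M[C]_m) : density S -> S^t* = S.
Proof. by case=> /hermP. Qed.

Lemma density_psd m (S : 'M[C]_m) : density S -> psd S.
Proof. by case. Qed.

Lemma density_tr m (S : 'M[C]_m) : density S -> Re (\tr S) = 1.
Proof. by case=> _ _ ->. Qed.

Lemma density_sum_ev m (S : 'M[C]_m) : density S -> \sum_i ev S i = 1.
Proof. by move=> dS; rewrite -(density_tr dS) (tr_ev (density_adj dS)). Qed.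

Lemma density_ev_ge0 m (S : 'M[C]_m) i : density S -> 0 <= ev S i.
Proof. by move=> dS; have [] := psd_ev (density_adj dS) => /(_ (density_psd dS)). Qed.

Lemma density_ev_le1 m (S : 'M[C]_m) i : density S -> ev S i <= 1.
Proof.
move=> dS; rewrite -(density_sum_ev dS) (bigD1 i)//= lerDl sumr_ge0// => j _.
exact: density_ev_ge0.
Qed.

Lemma density_mix m (A B : 'M[C]_m) (s : R) : 0 <= s <= 1 -> density A -> density B ->
  density ((1 - s)%:C *: A + s%:C *: B).
Proof.
move=> /andP[s0 s1] dA dB; split.
- by apply/hermP; rewrite adjD !adjZ !density_adj.
- by apply: psdD; apply: psdZ; rewrite ?subr_ge0//; exact: density_psd.
- rewrite mxtraceD !mxtraceZ; case: dA => _ _ ->; case: dB => _ _ ->.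
  by rewrite !mulr1 -rmorphD subrK.
Qed.

Lemma adj_tens m n p q (A : 'M[C]_(m, n)) (B : 'M[C]_(p, q)) :
  (A *t B)^t* = A^t* *t B^t*.
Proof. by rewrite trmx_tens map_mxT. Qed.

Lemma psd_tens m n (A : 'M[C]_m) (B : 'M[C]_n) : A^t* = A -> B^t* = B ->
  psd A -> psd B -> psd (A *t B).
Proof.
move=> hA hB pA pB; have [S hS ->] := psd_sqrt hA pA.
have [T hT ->] := psd_sqrt hB pB.
by rewrite -tensmx_mul -{1}hS -{1}hT -adj_tens; exact: psd_adjM.
Qed.

Lemma tr_tens m n (A : 'M[C]_m) (B : 'M[C]_n) : \tr (A *t B) = \tr A * \tr B.
Proof. by rewrite /mxtrace mulr_sum; apply: eq_bigr => k _; rewrite mxE. Qed.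

Lemma density_tens m n (A : 'M[C]_m) (B : 'M[C]_n) : density A -> density B ->
  density (A *t B).
Proof.
move=> dA dB.
split.
- by apply/hermP; rewrite adj_tens !density_adj.
- by apply: psd_tens; rewrite ?density_adj//; exact: density_psd.
- by rewrite tr_tens; case: dA => _ _ ->; case: dB => _ _ ->; rewrite mulr1.
Qed.

Lemma tr_xlogxE m (S : 'M[C]_m) : S^t* = S ->
  tr_xlogx S = \sum_i ev S i * ln (ev S i).
Proof.
move=> hS; rewrite /tr_xlogx /logm -[X in X *m _](mxfun_id hS) -mxfunM.
by rewrite tr_mxfun.
Qed.

(** [x log x] is convex, and the left-hand side is its tangent at [e]. *)
Lemma xlnx_ge_tangent (x e : R) : 0 <= x -> 0 < e -> x * (ln e + 1) - e <= x * ln x.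
Proof.
rewrite le_eqVlt => /predU1P[<-|x0] e0; first by rewrite !mul0r sub0r oppr_le0 ltW.
have : ln (e / x) <= e / x - 1.
  have := @le_ln1Dx _ (e / x - 1); rewrite (addrC 1) subrK; apply.
  by rewrite -subr_gt0 opprK subrK divr_gt0.
rewrite ln_div ?posrE// => h.
have : x * (ln e - ln x) <= x * (e / x - 1) by rewrite ler_pM2l.
by rewrite !mulrBr mulrCA mulfV ?gt_eqF//; lra.
Qed.

Lemma tr_xlogx_le0 m (S : 'M[C]_m) : density S -> tr_xlogx S <= 0.
Proof.
move=> dS; rewrite tr_xlogxE ?density_adj//; apply: sumr_le0 => i _.
by rewrite mulr_ge0_le0 ?density_ev_ge0// ln_le0// density_ev_le1.
Qed.

Lemma tr_xlogx_ge m (S : 'M[C]_m) : (0 < m)%N -> density S -> - ln m%:R <= tr_xlogx S.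
Proof.
move=> m0 dS; rewrite tr_xlogxE ?density_adj//.
have m0' : 0 < m%:R^-1 :> R by rewrite invr_gt0 ltr0n.
apply: (@le_trans _ _ (\sum_i (ev S i * (ln m%:R^-1 + 1) - m%:R^-1))).
  have e1 : \sum_(i < m) m%:R^-1 = 1 :> R.
    by rewrite sumr_const card_ord -[_ *+ m]mulr_natr mulVf// pnatr_eq0 -lt0n.
  rewrite big_split /= -mulr_suml (density_sum_ev dS) sumrN e1.
  by rewrite lnV ?posrE ?ltr0n//; lra.
by apply: ler_sum => i _; apply: xlnx_ge_tangent; rewrite ?density_ev_ge0.
Qed.

Lemma convex_comb_ge (s a b pa pb L e : R) : 0 <= s <= 1 ->
  a * L - e <= pa -> b * L - e <= pb ->
  ((1 - s) * a + s * b) * L - e <= (1 - s) * pa + s * pb.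
Proof.
move=> /andP[s0 s1] ha hb; have s1' : 0 <= 1 - s by rewrite subr_ge0.
apply: le_trans (lerD (ler_wpM2l s1' ha) (ler_wpM2l s0 hb)).
by rewrite le_eqVlt; apply/orP; left; apply/eqP; ring.
Qed.

(** Convexity of the entropy. In the eigenbasis [u] of the mixture, with
    eigenvalues [a], the tangent of [x log x] at [a] bounds [<u, (A log A) u>] and
    [<u, (B log B) u>] from below, and the sum over the basis is a trace. *)
Lemma tr_xlogx_mix_le m (A B : 'M[C]_m) (s : R) : 0 <= s <= 1 -> density A -> density B ->
  tr_xlogx ((1 - s)%:C *: A + s%:C *: B) <= (1 - s) * tr_xlogx A + s * tr_xlogx B.
Proof.
move=> s01 dA dB; have dM := density_mix s01 dA dB.
set M := _ + _ in dM *.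
pose q i (Z : 'M[C]_m) := Re (((eigvec M i)^t* *m Z *m eigvec M i) 0 0).
pose phi (x : R) := x * ln x.
have qD i Y Z : q i (Y + Z) = q i Y + q i Z.
  by rewrite /q mulmxDr mulmxDl mxE ReD.
have qZ i c Z : q i (c%:C *: Z) = c * q i Z.
  by rewrite /q -scalemxAr -scalemxAl mxE ReZ.
have q1 i : q i 1%:M = 1 by rewrite /q mulmx1 eigvec_norm.
have tangent (Z : 'M[C]_m) e i : density Z -> 0 < e ->
    q i Z * (ln e + 1) - e <= q i (mxfun phi Z).
  move=> dZ e0.
  have : psd (mxfun (fun x => phi x + (- (ln e + 1)) * idfun x + e) Z).
    apply/psd_mxfunP => j.
    have := xlnx_ge_tangent (density_ev_ge0 j dZ) e0.
    by rewrite /phi /=; move: (ln e) (ln _) (ev Z j); clear => L M0 x; lra.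
  move=> /(_ (eigvec M i)) /Re_ge0; rewrite -/(q i _).
  rewrite mxfunD mxfunD mxfunZ mxfun_cst (mxfun_id (density_adj dZ)) -scalemx1.
  rewrite !qD !qZ q1; move: (ln e) (q i _) (q i Z); clear => L a b; lra.
have sumq (Z : 'M[C]_m) : \sum_i q i Z = Re (\tr Z).
  by rewrite (tr_eigvec M) Re_sum.
have H (Z : 'M[C]_m) : density Z -> tr_xlogx Z = \sum_i q i (mxfun phi Z).
  by move=> dZ; rewrite sumq tr_mxfun tr_xlogxE ?density_adj.
rewrite (H A)// (H B)// tr_xlogxE ?density_adj// !mulr_sumr -big_split.
apply: ler_sum => i _ /=.
have qM : ev M i = (1 - s) * q i A + s * q i B.
  by rewrite -!qZ -qD /q -/M -[X in _ *m X *m _](mxfun_id (density_adj dM)) quad_eigvec.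
have key e : 0 < e -> ev M i * (ln e + 1) - e <=
    (1 - s) * q i (mxfun phi A) + s * q i (mxfun phi B).
  by move=> e0; rewrite qM; apply: convex_comb_ge => //; exact: tangent.
(* The tangent at 0 is vertical: for a zero eigenvalue, e tends to 0. *)
have := density_ev_ge0 i dM; rewrite le_eqVlt => /predU1P[e0|e0].
  rewrite -e0 mul0r; apply/ler_addgt0Pl => e /key.
  by rewrite -e0 mul0r lerBlDl.
by have := key _ e0; rewrite mulrDr mulr1 addrK.
Qed.

(** The smallest eigenvalue is at most [1 / m]. *)
Lemma norm_log_ge m (S : 'M[C]_m) : (0 < m)%N -> density S ->
  ((ln m%:R)%:E <= norm_log S)%E.
Proof.
move=> m0 dS; rewrite /norm_log; case: ifPn => [_|]; first by rewrite leey.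
rewrite -leqNgt => rk; rewrite lee_fin.
have [i /= li] : exists i, ev S i <= m%:R^-1.
  apply: contrapT => /forallNP h.
  have : \sum_(i < m) m%:R^-1 < \sum_i ev S i.
    apply: ltr_sum => [|i _]; last by rewrite ltNge; apply/negP/h.
    by apply/hasP; exists (Ordinal m0); rewrite ?mem_index_enum.
  rewrite density_sum_ev// sumr_const card_ord -[_ *+ m]mulr_natl mulfV ?ltxx//.
  by rewrite pnatr_eq0 -lt0n.
have e0 : 0 < ev S i.
  rewrite lt_neqAle density_ev_ge0// andbT; apply/negP => /eqP e0.
  have uS : S \in unitmx by rewrite -row_full_unit -col_leq_rank.
  have : S *m eigvec S i = 0.
    by rewrite -{1}(mxfun_id (density_adj dS)) mxfun_eigvec -e0 scale0r.
  move=> /(congr1 (mulmx (invmx S))); rewrite mulmx0 mulKmx// => z.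
  have := vec_norm_eigvec S i; rewrite z /vec_norm big1 ?sqrtr0; first by move/esym/eqP; rewrite oner_eq0.
  by move=> j _; rewrite mxE Normc.normc0 expr0n.
apply: le_trans (ev_mxfun_opnorm (@ln R) S i).
rewrite ler_normr; apply/orP; right; rewrite lerNr -lnV ?posrE ?ltr0n//.
by rewrite ler_ln ?posrE ?invr_gt0 ?ltr0n.
Qed.

Lemma entropy_term_ge d (T : measurableType d) (P : probability T R) m
    (X : T -> 'M[C]_m) eps (S : 'M[C]_m) :
  (0 < m)%N -> 0 <= eps -> density S -> eps * ln m%:R <= entropy_term P X eps S.
Proof.
move=> m0 e0 dS; rewrite /entropy_term ler_wpM2l//.
have h1 := norm_log_ge m0 dS.
have m0' : 0 < m%:R :> R by rewrite ltr0n.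
have h2 : ln m%:R <= ln (Gamma P X eps).
  by rewrite ler_ln ?posrE// /Gamma ?lt_max ?le_max ?m0' ?lexx orbT.
have : ((ln m%:R)%:E <= mine (norm_log S) (ln (Gamma P X eps))%:E)%E.
  by rewrite le_min h1 lee_fin.
rewrite /norm_log; case: ifP => _; last by rewrite -EFin_min.
by rewrite min_r ?leey.
Qed.

End Density.

(** * Bounded random variables and independence *)

Section Mean.
Context {R : realType} {d : measure_display} {T : measurableType d}.
Variable P : probability T R.

Lemma meanE (f : T -> R) : mean P f = fine (\int[P]_w (f w)%:E)%E.
Proof. by rewrite /mean unlock. Qed.

(** The joint law of [f] and [g] is the product of their laws, so that Fubini's
    theorem applies. *)
Lemma integral_mul_indep (f g : T -> R) :
  measurable_fun setT f -> measurable_fun setT g ->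
  P.-integrable setT (EFin \o f) -> P.-integrable setT (EFin \o g) ->
  P.-integrable setT (fun w => (f w * g w)%:E) ->
  (forall A B, measurable A -> measurable B ->
    P (f @^-1` A `&` g @^-1` B) = (P (f @^-1` A) * P (g @^-1` B))%E) ->
  (\int[P]_w (f w * g w)%:E = \int[P]_w (f w)%:E * \int[P]_w (g w)%:E)%E.
Proof.
move=> mf mg intf intg intfg ind.
pose f' : {mfun T >-> R} := mfun_Sub (mem_set mf).
pose g' : {mfun T >-> R} := mfun_Sub (mem_set mg).
have mh : measurable_fun setT (fun w => (f w, g w)) by exact: measurable_fun_pair.
pose h' : {mfun T >-> (R * R)%type} := mfun_Sub (mem_set mh).
pose F (z : R * R) : \bar R := (z.1 * z.2)%:E.
have FE x y : (F (x, y) = x%:E * y%:E)%E by [].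
have mF : measurable_fun [set: R * R] F.
  by apply/measurable_EFinP/measurable_funM; [exact: measurable_fst|exact: measurable_snd].
have -> : (\int[P]_w (f w * g w)%:E = \int[distribution P h']_z F z)%E.
  by rewrite integral_distribution.
have mu : forall X, measurable X ->
    (distribution P f' \x distribution P g')%E X = distribution P h' X.
  by apply: product_measure_unique => A B mA mB; exact: ind.
have -> : (\int[distribution P h']_z F z =
    \int[(distribution P f' \x distribution P g')%E]_z F z)%E.
  by apply: eq_measure_integral => A mA _; apply/esym; exact: mu.
have Ef : (\int[distribution P f']_x `|x%:E| = \int[P]_w `|(f w)%:E|)%E.
  by rewrite ge0_integral_distribution//; apply: measurableT_comp.
have Eg : (\int[distribution P g']_x `|x%:E| = \int[P]_w `|(g w)%:E|)%E.
  by rewrite ge0_integral_distribution//; apply: measurableT_comp.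
have finf : (\int[P]_w `|(f w)%:E| < +oo)%E by case/integrableP: intf.
have fing : (\int[P]_w `|(g w)%:E| < +oo)%E by case/integrableP: intg.
have intF : (distribution P f' \x distribution P g')%E.-integrable setT F.
  apply/integrable12ltyP => //.
  under eq_integral => x _.
    under eq_integral => y _ do rewrite FE abseM.
    rewrite ge0_integralZl//; last by apply: measurableT_comp.
    over.
  rewrite /= ge0_integralZr//; first last.
  - by apply: integral_ge0.
  - by apply: measurableT_comp.
  by rewrite Ef Eg lte_mul_pinfty// ?integral_ge0// ge0_fin_numE// integral_ge0.
rewrite -integral12_prod_meas1// /fubini_F.
have Ig : (\int[distribution P g']_y y%:E = \int[P]_w (g w)%:E)%E.
  by rewrite integral_distribution.
have If : (\int[distribution P f']_y y%:E = \int[P]_w (f w)%:E)%E.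
  by rewrite integral_distribution.
have iG : (distribution P g').-integrable setT EFin.
  by apply/integrableP; split => //; rewrite Eg.
have iF : (distribution P f').-integrable setT EFin.
  by apply/integrableP; split => //; rewrite Ef.
have fg : (\int[P]_w (g w)%:E \is a fin_num)%E by rewrite integrable_fin_num.
under eq_integral => x _.
  under eq_integral => y _ do rewrite FE.
  rewrite integralZl// Ig.
  over.
by rewrite /= -(fineK fg) integralZr// If.
Qed.

End Mean.

(** * Matrices with entries in an algebra of functions *)

Section FunctionAlgebra.
Context {R : realType} {T : Type}.
Local Notation C := R[i].

(** The measurable functions and the almost surely bounded functions are two
    algebras of this kind; all random matrices below are polynomials in the
    observations and inherit both properties from them. *)
Record funalg (A : (T -> C) -> Prop) : Prop := FunAlg {
  funalg_cst : forall c, A (fun=> c);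
  funalgD : forall f g, A f -> A g -> A (fun w => f w + g w);
  funalgM : forall f g, A f -> A g -> A (fun w => f w * g w);
  funalg_conj : forall f, A f -> A (fun w => Num.conj (f w)) }.

Definition mxin (A : (T -> C) -> Prop) p q (Z : T -> 'M[C]_(p, q)) :=
  forall i j, A (fun w => Z w i j).

Variable A : (T -> C) -> Prop.
Hypothesis algA : funalg A.

Lemma funalg_sum I (s : seq I) (Q : pred I) (f : I -> T -> C) :
  (forall i, Q i -> A (f i)) -> A (fun w => \sum_(i <- s | Q i) f i w).
Proof.
move=> fA; elim: s => [|i s IH].
  by under eq_fun => w do rewrite big_nil; exact: funalg_cst.
under eq_fun => w do rewrite big_cons; case: (boolP (Q i)) => [Qi|_]; last exact: IH.
by apply: funalgD => //; exact: fA.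
Qed.

Lemma mxin_cst p q (M : 'M[C]_(p, q)) : mxin A (fun=> M).
Proof. by move=> i j; exact: funalg_cst. Qed.

Lemma mxinD p q (Y Z : T -> 'M[C]_(p, q)) : mxin A Y -> mxin A Z ->
  mxin A (fun w => Y w + Z w).
Proof. by move=> hY hZ i j; under eq_fun => w do rewrite mxE; exact: funalgD. Qed.

Lemma mxinM p q r (Y : T -> 'M[C]_(p, q)) (Z : T -> 'M[C]_(q, r)) :
  mxin A Y -> mxin A Z -> mxin A (fun w => Y w *m Z w).
Proof.
move=> hY hZ i j; under eq_fun => w do rewrite mxE.
by apply: funalg_sum => k _; exact: funalgM.
Qed.

Lemma mxinZ p q (c : C) (Z : T -> 'M[C]_(p, q)) : mxin A Z ->
  mxin A (fun w => c *: Z w).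
Proof.
move=> hZ i j; under eq_fun => w do rewrite mxE.
by apply: funalgM => //; exact: funalg_cst.
Qed.

Lemma mxinN p q (Z : T -> 'M[C]_(p, q)) : mxin A Z -> mxin A (fun w => - Z w).
Proof. by move=> /(mxinZ (-1)); under eq_fun => w do rewrite scaleN1r. Qed.

Lemma mxinB p q (Y Z : T -> 'M[C]_(p, q)) : mxin A Y -> mxin A Z ->
  mxin A (fun w => Y w - Z w).
Proof. by move=> hY hZ; apply: mxinD => //; exact: mxinN. Qed.

Lemma mxinX p (Z : T -> 'M[C]_p) k : mxin A Z -> mxin A (fun w => Z w ^+ k).
Proof.
move=> hZ; elim: k => [|k IH]; first exact: mxin_cst.
by under eq_fun => w do rewrite exprS; exact: mxinM.
Qed.

Lemma mxin_sum p q I (s : seq I) (Q : pred I) (Z : I -> T -> 'M[C]_(p, q)) :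
  (forall i, Q i -> mxin A (Z i)) -> mxin A (fun w => \sum_(i <- s | Q i) Z i w).
Proof.
move=> hZ i j; under eq_fun => w do rewrite summxE.
by apply: funalg_sum => k Qk; exact: hZ.
Qed.

Lemma mxin_tens p q r s (Y : T -> 'M[C]_(p, q)) (Z : T -> 'M[C]_(r, s)) :
  mxin A Y -> mxin A Z -> mxin A (fun w => Y w *t Z w).
Proof. by move=> hY hZ i j; under eq_fun => w do rewrite mxE; exact: funalgM. Qed.

Lemma mxin_scalar p (f : T -> C) : A f -> mxin A (fun w => (f w)%:M : 'M[C]_p).
Proof.
move=> hf i j; case: (eqVneq i j) => [->|ij].
  by under eq_fun => w do rewrite mxE eqxx mulr1n.
by under eq_fun => w do rewrite mxE (negPf ij) mulr0n; exact: funalg_cst.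
Qed.

Lemma funalg_tr p (Z : T -> 'M[C]_p) : mxin A Z -> A (fun w => \tr (Z w)).
Proof. by move=> hZ; apply: funalg_sum => i _; exact: hZ. Qed.

End FunctionAlgebra.

HB.instance Definition _ (R : realType) := isPointed.Build R[i] 0.

Section Measurability.
Context {R : realType} {T : pointedType}.
Variable G : set (set T).
Local Notation C := R[i].

Definition mfun_C (f : T -> C) :=
  measurable_fun setT (fun w : g_sigma_algebraType G => Re (f w)) /\
  measurable_fun setT (fun w : g_sigma_algebraType G => Im (f w)).

Lemma ReM (x y : C) : Re (x * y) = Re x * Re y - Im x * Im y.
Proof. by case: x; case: y. Qed.

Lemma ImM (x y : C) : Im (x * y) = Re x * Im y + Im x * Re y.
Proof. by case: x; case: y. Qed.

Lemma ImD (x y : C) : Im (x + y) = Im x + Im y.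
Proof. by case: x; case: y. Qed.

Lemma funalg_mfun : funalg mfun_C.
Proof.
split.
- by move=> c; split; exact: measurable_cst.
- move=> f g [f1 f2] [g1 g2]; split.
    by under eq_fun => w do rewrite ReD; exact: measurable_funD.
  by under eq_fun => w do rewrite ImD; exact: measurable_funD.
- move=> f g [f1 f2] [g1 g2]; split.
    under eq_fun => w do rewrite ReM.
    by apply: measurable_funB; exact: measurable_funM.
  under eq_fun => w do rewrite ImM.
  by apply: measurable_funD; exact: measurable_funM.
- move=> f [f1 f2]; split.
    by apply: eq_measurable_fun f1 => w _; case: (f w).
  apply: eq_measurable_fun (measurable_funN f2) => w _ /=.
  by case: (f w) => x y.
Qed.

End Measurability.

Section Boundedness.
Context {R : realType} {d : measure_display} {T : measurableType d}.
Variable P : probability T R.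
Local Notation C := R[i].

Definition aebdd (f : T -> C) := exists K : R, {ae P, forall w, nc (f w) <= K}.

Lemma funalg_aebdd : funalg aebdd.
Proof.
split.
- by move=> c; exists (nc c); exact: aeW.
- move=> f g [K hK] [L hL]; exists (K + L); apply: filterS2 hK hL => w h1 h2.
  by apply: le_trans (le_normcD _ _) _; exact: lerD.
- move=> f g [K hK] [L hL]; exists (K * L); apply: filterS2 hK hL => w h1 h2.
  by rewrite Normc.normcM ler_pM ?nc_ge0.
- move=> f [K hK]; exists K; apply: filterS hK => w.
  by have := norm_conjC (f w); rewrite !norm_nc => /complexI ->.
Qed.

(** The parameter [G] records on which observations [f] depends; independence
    is stated between such classes of events. *)
Definition bdd (G : set (set T)) (f : T -> C) := mfun_C G f /\ aebdd f.

Lemma funalg_bdd G : funalg (bdd G).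
Proof.
have hm := @funalg_mfun R T G; have hb := funalg_aebdd; split.
- by move=> c; split; [exact: funalg_cst hm c|exact: funalg_cst hb c].
- by move=> f g [f1 f2] [g1 g2]; split; [exact: funalgD hm _ _ f1 g1|exact: funalgD hb _ _ f2 g2].
- by move=> f g [f1 f2] [g1 g2]; split; [exact: funalgM hm _ _ f1 g1|exact: funalgM hb _ _ f2 g2].
- by move=> f [f1 f2]; split; [exact: funalg_conj hm _ f1|exact: funalg_conj hb _ f2].
Qed.

Lemma measurable_fun_gen (G H : set (set T)) (f : T -> R) : <<s G >> `<=` <<s H >> ->
  measurable_fun setT (f : g_sigma_algebraType G -> R) ->
  measurable_fun setT (f : g_sigma_algebraType H -> R).
Proof. by move=> GH mf _ B mB; apply: GH; exact: mf. Qed.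

Lemma bddS (G H : set (set T)) f : <<s G >> `<=` <<s H >> -> bdd G f -> bdd H f.
Proof.
by move=> GH [[f1 f2] fb]; split=> //; split; exact: measurable_fun_gen GH _.
Qed.

Lemma mxin_bddS (G H : set (set T)) p q (Z : T -> 'M[C]_(p, q)) :
  <<s G >> `<=` <<s H >> -> mxin (bdd G) Z -> mxin (bdd H) Z.
Proof. by move=> GH hZ i j; apply: bddS GH _; exact: hZ. Qed.

Lemma measurable_gen (f : T -> R) :
  measurable_fun setT (f : g_sigma_algebraType measurable -> R) ->
  measurable_fun setT f.
Proof.
move=> mf _ B mB; have := mf measurableT B mB.
by rewrite /measurable /= sigma_algebra_id//; exact: sigma_algebra_measurable.
Qed.

Lemma sub_gen_measurable (G : set (set T)) : G `<=` measurable ->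
  <<s G >> `<=` <<s measurable >>.
Proof. exact: sub_sigma_algebra2. Qed.

Local Notation rv := (bdd measurable).

Lemma integrable_rv (f : T -> R) (K : R) : measurable_fun setT f ->
  {ae P, forall w, `|f w| <= K} -> P.-integrable setT (EFin \o f).
Proof.
move=> mf hK; apply/integrableP; split; first exact/measurable_EFinP.
apply: (@le_lt_trans _ _ (\int[P]_w (`|K|%:E))%E).
  apply: ae_ge0_le_integral => //.
  - by apply: measurableT_comp => //; exact/measurable_EFinP.
  - by apply: filterS hK => w h _; rewrite /= lee_fin (le_trans h)// ler_norm.
by rewrite integral_cst//= probability_setT mule1 ltry.
Qed.

Lemma bdd_Re_integrable f : rv f -> P.-integrable setT (fun w => (Re (f w))%:E).
Proof.
move=> [[f1 _] [K hK]]; apply: (integrable_rv (K := K)); first exact: measurable_gen.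
by apply: filterS hK => w; apply: le_trans; exact: Re_le_nc.
Qed.

Lemma Im_le_nc (z : C) : `|Im z| <= nc z.
Proof.
by case: z => x y; rewrite /= -sqrtr_sqr ler_wsqrtr// lerDr sqr_ge0.
Qed.

Lemma bdd_Im_integrable f : rv f -> P.-integrable setT (fun w => (Im (f w))%:E).
Proof.
move=> [[_ f2] [K hK]]; apply: (integrable_rv (K := K)); first exact: measurable_gen.
by apply: filterS hK => w; apply: le_trans; exact: Im_le_nc.
Qed.

(** ** Expectations *)

Lemma integrable_oppr (f : T -> R) : P.-integrable setT (EFin \o f) ->
  P.-integrable setT (EFin \o (fun w => - f w)).
Proof.
move=> hf; rewrite (_ : EFin \o _ = -%E \o (EFin \o f)); first exact: integrableN.
by apply/funext => w /=; rewrite EFinN.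
Qed.

Lemma meanD (f g : T -> R) : P.-integrable setT (EFin \o f) -> P.-integrable setT (EFin \o g) ->
  mean P (fun w => f w + g w) = mean P f + mean P g.
Proof.
by move=> hf hg; rewrite !meanE integralD_EFin// fineD ?integrable_fin_num.
Qed.

Lemma meanZ (c : R) (f : T -> R) : P.-integrable setT (EFin \o f) ->
  mean P (fun w => c * f w) = c * mean P f.
Proof.
move=> hf; rewrite !meanE; under eq_integral do rewrite EFinM.
by rewrite integralZl// fineM// integrable_fin_num.
Qed.

Lemma meanN (f : T -> R) : P.-integrable setT (EFin \o f) -> mean P (fun w => - f w) = - mean P f.
Proof.
by move=> hf; rewrite -mulN1r -meanZ//; congr mean; apply/funext => w; rewrite mulN1r.
Qed.

Lemma mean_cst c : mean P (fun=> c) = c.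
Proof. by rewrite meanE integral_cst//= probability_setT mule1. Qed.

Lemma ae_mean_eq (f g : T -> R) : measurable_fun setT f -> measurable_fun setT g ->
  {ae P, forall w, f w = g w} -> mean P f = mean P g.
Proof.
move=> mf mg h; rewrite !meanE; congr fine; apply: ae_eq_integral => //.
- exact/measurable_EFinP.
- exact/measurable_EFinP.
- by apply: filterS h => w -> _.
Qed.

Lemma ae_mean_ge0 (f : T -> R) : P.-integrable setT (EFin \o f) -> {ae P, forall w, 0 <= f w} ->
  0 <= mean P f.
Proof.
move=> hf h; have mf : measurable_fun setT f by case/integrableP: hf => /measurable_EFinP.
have -> : mean P f = mean P (fun w => `|f w|).
  apply: ae_mean_eq => //; first exact: measurableT_comp.
  by apply: filterS h => w f0; rewrite ger0_norm.
by rewrite meanE fine_ge0// integral_ge0// => w _; rewrite lee_fin.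
Qed.

Lemma ae_mean_le (f g : T -> R) : P.-integrable setT (EFin \o f) -> P.-integrable setT (EFin \o g) ->
  {ae P, forall w, f w <= g w} -> mean P f <= mean P g.
Proof.
move=> hf hg h; rewrite -subr_ge0 -meanN// -meanD//; last first.
  exact: integrable_oppr.
apply: ae_mean_ge0; last by apply: filterS h => w; rewrite subr_ge0.
rewrite (_ : EFin \o _ = ((EFin \o g) \- (EFin \o f))%E); first exact: integrableB.
by apply/funext => w /=; rewrite EFinB.
Qed.

Definition cmean (f : T -> C) : C := mean P (fun w => Re (f w)) +i* mean P (fun w => Im (f w)).

Lemma cmean_cst c : cmean (fun=> c) = c.
Proof. by rewrite /cmean !mean_cst; case: c. Qed.

Lemma cmeanD f g : rv f -> rv g -> cmean (fun w => f w + g w) = cmean f + cmean g.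
Proof.
move=> hf hg; rewrite /cmean; apply/eqP; rewrite eq_complex /=; apply/andP; split; apply/eqP.
  under eq_fun => w do rewrite ReD.
  by rewrite meanD//; exact: bdd_Re_integrable.
under eq_fun => w do rewrite ImD.
by rewrite meanD//; exact: bdd_Im_integrable.
Qed.

Lemma cmeanM (G H : set (set T)) f g : G `<=` measurable -> H `<=` measurable ->
  independent P <<s G >> <<s H >> -> bdd G f -> bdd H g ->
  cmean (fun w => f w * g w) = cmean f * cmean g.
Proof.
move=> Gm Hm ind hf hg.
have rf : rv f by apply: bddS hf; exact: sub_gen_measurable.
have rg : rv g by apply: bddS hg; exact: sub_gen_measurable.
have prod (a b : T -> R) K L :
    measurable_fun setT (a : g_sigma_algebraType G -> R) ->
    measurable_fun setT (b : g_sigma_algebraType H -> R) ->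
    {ae P, forall w, `|a w| <= K} -> {ae P, forall w, `|b w| <= L} ->
    P.-integrable setT (EFin \o (fun w => a w * b w)) /\
    mean P (fun w => a w * b w) = mean P a * mean P b.
  move=> ma mb hK hL.
  have ma' : measurable_fun setT a.
    by apply: measurable_gen; apply: measurable_fun_gen ma; exact: sub_gen_measurable.
  have mb' : measurable_fun setT b.
    by apply: measurable_gen; apply: measurable_fun_gen mb; exact: sub_gen_measurable.
  have ia := integrable_rv ma' hK; have ib := integrable_rv mb' hL.
  have iab : P.-integrable setT (EFin \o (fun w => a w * b w)).
    apply: (integrable_rv (K := K * L)); first exact: measurable_funM.
    by apply: filterS2 hK hL => w h1 h2; rewrite normrM ler_pM.
  split=> //; rewrite !meanE -fineM ?integrable_fin_num//; congr fine.
  apply: integral_mul_indep => // A B mA mB; apply: ind.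
    by have := ma measurableT A mA; rewrite setTI.
  by have := mb measurableT B mB; rewrite setTI.
case: hf hg => [[f1 f2] [K hK]] [[g1 g2] [L hL]].
have fR : {ae P, forall w, `|Re (f w)| <= K}.
  by apply: filterS hK => w; apply: le_trans; exact: Re_le_nc.
have fI : {ae P, forall w, `|Im (f w)| <= K}.
  by apply: filterS hK => w; apply: le_trans; exact: Im_le_nc.
have gR : {ae P, forall w, `|Re (g w)| <= L}.
  by apply: filterS hL => w; apply: le_trans; exact: Re_le_nc.
have gI : {ae P, forall w, `|Im (g w)| <= L}.
  by apply: filterS hL => w; apply: le_trans; exact: Im_le_nc.
have [iRR eRR] := prod _ _ _ _ f1 g1 fR gR.
have [iRI eRI] := prod _ _ _ _ f1 g2 fR gI.
have [iIR eIR] := prod _ _ _ _ f2 g1 fI gR.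
have [iII eII] := prod _ _ _ _ f2 g2 fI gI.
rewrite /cmean.
have -> : mean P (fun w => Re (f w * g w)) =
    mean P (fun w => Re (f w) * Re (g w) + - (Im (f w) * Im (g w))).
  by congr mean; apply/funext => w; rewrite ReM.
have -> : mean P (fun w => Im (f w * g w)) =
    mean P (fun w => Re (f w) * Im (g w) + Im (f w) * Re (g w)).
  by congr mean; apply/funext => w; rewrite ImM.
rewrite meanD//; last exact: integrable_oppr.
by rewrite meanN// meanD// eRR eII eRI eIR.
Qed.

(** A constant is measurable for the trivial sigma-algebra, which is independent
    of every other one. *)
Lemma cmeanZ c f : rv f -> cmean (fun w => c * f w) = c * cmean f.
Proof.
move=> hf; have ind : independent P <<s set0 >> <<s measurable >>.
  have s0 : sigma_algebra setT [set set0; setT : set T].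
    split; first by left.
      by move=> A [->|->]; [right; rewrite setD0|left; rewrite setDv].
    move=> A hA; have [[n An]|h] := pselect (exists n, A n = setT).
      by right; apply/seteqP; split=> // x _; exists n => //; rewrite An.
    left; apply/seteqP; split=> // x [n _]; case: (hA n) => [->//|An].
    by exfalso; apply: h; exists n.
  move=> A B /(_ _ (conj s0 _)) [//|->|->] _; first by rewrite set0I measure0 mul0e.
  by rewrite setTI probability_setT mul1e.
have hc : bdd set0 (fun=> c) by exact: funalg_cst (funalg_bdd set0) c.
by rewrite (cmeanM _ _ ind hc hf)// cmean_cst.
Qed.

Lemma cmean_sum I (s : seq I) (f : I -> T -> C) : (forall i, rv (f i)) ->
  cmean (fun w => \sum_(i <- s) f i w) = \sum_(i <- s) cmean (f i).
Proof.
move=> hf; elim: s => [|i s IH].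
  by under eq_fun => w do rewrite big_nil; rewrite cmean_cst big_nil.
under eq_fun => w do rewrite big_cons.
rewrite big_cons -IH cmeanD//.
by apply: (funalg_sum (funalg_bdd measurable)).
Qed.

Lemma cmean_conj f : rv f -> cmean (fun w => Num.conj (f w)) = Num.conj (cmean f).
Proof.
move=> hf; rewrite /cmean -[RHS]/(_ +i* _); congr (_ +i* _).
  by congr mean; apply/funext => w; case: (f w).
rewrite -meanN//; last exact: bdd_Im_integrable.
by congr mean; apply/funext => w; case: (f w).
Qed.

(** ** Expectations of matrices *)

Local Notation rvmx := (mxin rv).

Lemma mxmean_cst p q (M : 'M[C]_(p, q)) : mxmean P (fun=> M) = M.
Proof. by apply/matrixP => i j; rewrite mxE -/(cmean _) cmean_cst. Qed.

Lemma mxmeanD p q (Y Z : T -> 'M[C]_(p, q)) : rvmx Y -> rvmx Z ->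
  mxmean P (fun w => Y w + Z w) = mxmean P Y + mxmean P Z.
Proof.
move=> hY hZ; apply/matrixP => i j; rewrite !mxE -!/(cmean _) -cmeanD//.
by congr cmean; apply/funext => w; rewrite mxE.
Qed.

Lemma mxmeanM (G H : set (set T)) p q r (Y : T -> 'M[C]_(p, q)) (Z : T -> 'M[C]_(q, r)) :
  G `<=` measurable -> H `<=` measurable -> independent P <<s G >> <<s H >> ->
  mxin (bdd G) Y -> mxin (bdd H) Z ->
  mxmean P (fun w => Y w *m Z w) = mxmean P Y *m mxmean P Z.
Proof.
move=> Gm Hm ind hY hZ.
have rY : rvmx Y by apply: mxin_bddS hY; exact: sub_gen_measurable.
have rZ : rvmx Z by apply: mxin_bddS hZ; exact: sub_gen_measurable.
apply/matrixP => i j; rewrite !mxE -/(cmean _).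
under [in LHS]eq_fun => w do rewrite mxE.
rewrite cmean_sum; last by move=> k; exact: funalgM (funalg_bdd _) _ _ (rY i k) (rZ k j).
by apply: eq_bigr => k _; rewrite (cmeanM _ _ ind (hY i k) (hZ k j))// !mxE.
Qed.

Lemma mxmean_mull p q r (M : 'M[C]_(p, q)) (Z : T -> 'M[C]_(q, r)) : rvmx Z ->
  mxmean P (fun w => M *m Z w) = M *m mxmean P Z.
Proof.
move=> rZ; apply/matrixP => i j; rewrite !mxE -/(cmean _).
under [in LHS]eq_fun => w do rewrite mxE.
rewrite cmean_sum; last first.
  by move=> k; apply: (funalgM (funalg_bdd _)) (rZ k j); exact: funalg_cst (funalg_bdd _) _.
by apply: eq_bigr => k _; rewrite cmeanZ// !mxE.
Qed.

Lemma mxmeanZ p q c (Z : T -> 'M[C]_(p, q)) : rvmx Z ->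
  mxmean P (fun w => c *: Z w) = c *: mxmean P Z.
Proof.
move=> rZ; rewrite -mul_scalar_mx -mxmean_mull//.
by congr mxmean; apply/funext => w; rewrite mul_scalar_mx.
Qed.

Lemma mxmeanN p q (Z : T -> 'M[C]_(p, q)) : rvmx Z ->
  mxmean P (fun w => - Z w) = - mxmean P Z.
Proof.
move=> rZ; rewrite -scaleN1r -mxmeanZ//.
by congr mxmean; apply/funext => w; rewrite scaleN1r.
Qed.

Lemma mxmeanB p q (Y Z : T -> 'M[C]_(p, q)) : rvmx Y -> rvmx Z ->
  mxmean P (fun w => Y w - Z w) = mxmean P Y - mxmean P Z.
Proof.
by move=> hY hZ; rewrite mxmeanD ?mxmeanN//; apply: mxinN hZ; exact: funalg_bdd.
Qed.

Lemma mxmean_adj p q (Z : T -> 'M[C]_(p, q)) : rvmx Z ->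
  mxmean P (fun w => (Z w)^t*) = (mxmean P Z)^t*.
Proof.
move=> rZ; apply/matrixP => i j; rewrite !mxE -!/(cmean _) -cmean_conj//.
by congr cmean; apply/funext => w; rewrite !mxE.
Qed.

Lemma tr_mxmean p (Z : T -> 'M[C]_p) : rvmx Z ->
  \tr (mxmean P Z) = cmean (fun w => \tr (Z w)).
Proof.
move=> rZ; rewrite /mxtrace cmean_sum//.
by apply: eq_bigr => i _; rewrite mxE.
Qed.

Lemma mxmean_mulr p q r (M : 'M[C]_(q, r)) (Z : T -> 'M[C]_(p, q)) : rvmx Z ->
  mxmean P (fun w => Z w *m M) = mxmean P Z *m M.
Proof.
move=> rZ; apply/matrixP => i j; rewrite !mxE -/(cmean _).
under [in LHS]eq_fun => w do rewrite mxE.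
have hc k : rv (fun=> M k j) by exact: funalg_cst (funalg_bdd _) _.
rewrite cmean_sum; last by move=> k; exact: funalgM (funalg_bdd _) _ _ (rZ i k) (hc k).
apply: eq_bigr => k _; rewrite mulrC mxE -/(cmean _) -cmeanZ//.
by congr cmean; apply/funext => w; rewrite mulrC.
Qed.

Lemma psd_mxmean p (Z : T -> 'M[C]_p) : rvmx Z -> {ae P, forall w, psd (Z w)} ->
  psd (mxmean P Z).
Proof.
move=> rZ h x.
have alg := funalg_bdd measurable.
have r1 : rvmx (fun w => x^t* *m Z w) := mxinM alg (mxin_cst alg (x^t* )) rZ.
have r2 : rvmx (fun w => x^t* *m Z w *m x) := mxinM alg r1 (mxin_cst alg x).
rewrite -mxmean_mull// -mxmean_mulr// mxE lecE; apply/andP; split.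
  rewrite /= (@ae_mean_eq _ (fun=> 0)) ?mean_cst//.
    by apply: measurable_gen; have [[_ +] _] := r2 0 0.
  by apply: filterS h => w /(_ x) /ger0_Im.
apply: ae_mean_ge0; first exact: bdd_Re_integrable (r2 0 0).
by apply: filterS h => w /(_ x) /Re_ge0.
Qed.

Lemma ae_rowbd p (Z : T -> 'M[C]_p) : mxin aebdd Z ->
  exists2 K, 0 <= K & {ae P, forall w, rowbd (Z w) K}.
Proof.
move=> hZ; have /choice[K hK] : forall ij : 'I_p * 'I_p, exists k : R,
    {ae P, forall w, nc (Z w ij.1 ij.2) <= k} by move=> ij; exact: hZ.
exists (\sum_i \sum_j `|K (i, j)|).
  by apply: sumr_ge0 => i _; apply: sumr_ge0.
have : {ae P, forall w, forall ij, nc (Z w ij.1 ij.2) <= K ij} by exact: filter_forall.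
apply: filterS => w h i.
apply: (@le_trans _ _ (\sum_j `|K (i, j)|)).
  by apply: ler_sum => j _; apply: le_trans (h (i, j)) (ler_norm _).
by rewrite [leRHS](bigD1 i)//= lerDl; apply: sumr_ge0 => k _; apply: sumr_ge0.
Qed.

End Boundedness.

(** * A matrix Bernstein inequality *)

Section ScalarBounds.
Context {R : realType}.

Lemma expR_half_le (u : R) : 0 <= u <= 1 -> expR (u / 2) <= 1 + u.
Proof.
move=> /andP[u0 u1]; have e1 : 1 - u / 2 <= expR (- (u / 2)) := expR_ge1Dx _.
have e2 : expR (u / 2) * expR (- (u / 2)) = 1 by rewrite -expRD subrr expR0.
have h : 1 <= (1 + u) * (1 - u / 2) by nra.
have p0 : 0 < expR (- (u / 2)) := expR_gt0 _.
rewrite -(ler_pM2r p0) e2; apply: le_trans h _.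
by rewrite ler_wpM2l// addr_ge0.
Qed.

Lemma affine_pow_ge_expR (x : R) N : 0 <= x -> x <= N%:R -> (0 < N)%N ->
  expR (x / 2) <= (1 + N%:R^-1 * x) ^+ N.
Proof.
move=> x0 xN N0; have N0' : 0 < N%:R :> R by rewrite ltr0n.
have -> : x / 2 = N%:R * (N%:R^-1 * x / 2) by field; rewrite gt_eqF.
rewrite expRM_natl lerXn2r ?nnegrE ?expR_ge0//.
  by rewrite addr_ge0// mulr_ge0// invr_ge0 ltW.
apply: expR_half_le; rewrite ler_pdivrMl// mulr1 xN andbT.
by rewrite mulr_ge0// invr_ge0 ltW.
Qed.

Lemma onePpow_le_expR (x : R) n : 0 <= x -> (1 + x) ^+ n <= expR (n%:R * x).
Proof.
move=> x0; rewrite expRM_natl lerXn2r ?nnegrE ?expR_ge0 ?expR_ge1Dx//.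
by rewrite addr_ge0.
Qed.

End ScalarBounds.

Section Bernstein.
Context {R : realType} {d : measure_display} {T : measurableType d}.
Variable P : probability T R.
Local Notation C := R[i].
Local Notation rvmx := (mxin (bdd P measurable)).
Variables (p n : nat) (Z : 'I_n -> T -> 'M[C]_p) (G : 'I_n -> set (set T)).
Variables (V v : R).

Definition past k : set (set T) := \bigcup_(i in [set i : 'I_n | (i < k)%N]) G i.

Hypothesis Gm : forall i, G i `<=` measurable.
Hypothesis ind : forall k : 'I_n, independent P <<s past k >> <<s G k >>.
Hypothesis ZG : forall j, mxin (bdd P (G j)) (Z j).
Hypothesis Zadj : forall j w, (Z j w)^t* = Z j w.
Hypothesis ZV : forall j, {ae P, forall w, mxbound V (Z j w)}.
Hypothesis Z0 : forall j, mxmean P (Z j) = 0.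
Hypothesis Zv : forall j, psd (v%:C%:M - mxmean P (fun w => Z j w *m Z j w)).
Hypothesis V0 : 0 < V.
Hypothesis v0 : 0 <= v.

Let alg := funalg_bdd P measurable.

Definition psum k w : 'M[C]_p := \sum_(i < n | (i < k)%N) Z i w.

Lemma psumS (k : 'I_n) w : psum k.+1 w = psum k w + Z k w.
Proof.
rewrite /psum (bigD1 k)//= addrC; congr (_ + _); apply: eq_bigl => i.
by rewrite ltnS ltn_neqAle andbC.
Qed.

Lemma psum_adj k w : (psum k w)^t* = psum k w.
Proof.
rewrite /psum; elim/big_rec : _ => [|i M _ IH]; first by rewrite trmx0 map_mx0.
by rewrite adjD Zadj IH.
Qed.

Lemma past_measurable k : past k `<=` measurable.
Proof. by move=> A [i _ /Gm]. Qed.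

Lemma bdd_psum k : mxin (bdd P (past k)) (psum k).
Proof.
apply: (mxin_sum (funalg_bdd P (past k))) => i ik.
by apply: mxin_bddS (ZG i); apply: sub_sigma_algebra2 => A GA; exists i.
Qed.

Lemma rv_psum k : rvmx (psum k).
Proof. by apply: mxin_bddS (bdd_psum k); apply: sub_gen_measurable; exact: past_measurable. Qed.

Lemma rv_Z j : rvmx (Z j).
Proof. by apply: mxin_bddS (ZG j); apply: sub_gen_measurable; exact: Gm. Qed.

Section Step.
Variables (th K : R).
Hypothesis th0 : 0 < th.
Hypothesis thV : th * V <= 2^-1.
Hypothesis K0 : 0 <= K.
Hypothesis ZK : {ae P, forall w, forall k, rowbd (th%:C *: psum k w) K}.
Hypothesis ZK' : forall j, {ae P, forall w, rowbd (th%:C *: Z j w) K}.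
Variable e : nat.
Let N := (2 ^ e.+1)%N.
Let c : R := N%:R^-1.

Definition trpow k w := Re (\tr ((1%:M + c%:C *: (th%:C *: psum k w)) ^+ N)).

Let kappa := expR (K + K) * (K * K).
Let q := 1 + 2 * th ^+ 2 * v.

Lemma rv_affine_pow H (Y : T -> 'M[C]_p) : mxin (bdd P H) Y ->
  mxin (bdd P H) (fun w => (1%:M + c%:C *: (th%:C *: Y w)) ^+ N).
Proof.
move=> hY; have aH := funalg_bdd P H.
exact: (mxinX aH _ (mxinD aH (mxin_cst aH _) (mxinZ aH _ (mxinZ aH _ hY)))).
Qed.

(** [Z j] has mean zero, so that only the quadratic term of
    [1 + th Z + 2 th ^ 2 Z ^ 2] survives in the mean. *)
Lemma mean_affine_pow_le j :
  psd (q%:C%:M - mxmean P (fun w => (1%:M + c%:C *: (th%:C *: Z j w)) ^+ N)).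
Proof.
have rZ := rv_Z j.
have rtZ : rvmx (fun w => th%:C *: Z j w) by exact: mxinZ.
have rZZ : rvmx (fun w => Z j w *m Z j w) by exact: mxinM.
have rQ := rv_affine_pow rZ.
have r1 : rvmx (fun=> 1%:M : 'M[C]_p) := mxin_cst alg _.
have r2 := mxinD alg r1 rtZ.
have rZZ2 := mxinZ alg (2 * th ^+ 2)%:C rZZ.
have r3 := mxinD alg r2 rZZ2.
have h : psd (mxmean P (fun w => 1%:M + th%:C *: Z j w + (2 * th ^+ 2)%:C *: (Z j w *m Z j w)
    - (1%:M + c%:C *: (th%:C *: Z j w)) ^+ N)).
  apply: (psd_mxmean (mxinB alg r3 rQ)).
  apply: filterS (ZV j) => w /(mxboundP _ (Zadj j w)) hV.
  have hA : (th%:C *: Z j w)^t* = th%:C *: Z j w by rewrite adjZ Zadj.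
  have := @affine_pow_le_quadratic R p (th%:C *: Z j w) N hA.
  have -> : 2%:C *: ((th%:C *: Z j w) *m (th%:C *: Z j w)) =
      (2 * th ^+ 2)%:C *: (Z j w *m Z j w).
    by rewrite -scalemxAl -scalemxAr !scalerA -!rmorphM -mulrA -expr2.
  apply; first by rewrite expn_gt0.
  have b1 : mxbound (th * V) (th%:C *: Z j w).
    have [h1 h2] := (mxboundP V (Zadj j w)).2 hV.
    have e1 : (th * V)%:C%:M = th%:C *: (V%:C%:M : 'M[C]_p).
      by rewrite scale_scalar_mx rmorphM.
    split; rewrite e1; first by rewrite -scalerBr; apply: psdZ (ltW th0) h1.
    by rewrite -scalerDr; apply: psdZ (ltW th0) h2.
  by move=> i; apply: le_trans thV; exact: (mxboundP _ hA).1.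
rewrite (mxmeanB r3 rQ) (mxmeanD r2 rZZ2) (mxmeanD r1 rtZ) mxmean_cst in h.
rewrite (mxmeanZ _ rZ) Z0 scaler0 addr0 (mxmeanZ _ rZZ) in h.
have q2 : 0 <= 2 * th ^+ 2 by rewrite mulr_ge0// sqr_ge0.
have := psdD h (psdZ q2 (Zv j)).
rewrite scalerBr scale_scalar_mx -rmorphM addrA.
rewrite (addrAC _ (- mxmean P (fun w => (_ + _) ^+ N))).
rewrite (addrAC _ (- mxmean P (fun w => (_ + _) ^+ N))).
by rewrite (addrAC 1%:M) addrK /q rmorphD raddfD.
Qed.

(** Golden-Thompson separates [Z k] from the past, independence factors the
    expectation, and the factor of [Z k] is at most [q] times the identity. *)
Lemma trpow_step (k : 'I_n) :
  mean P (trpow k.+1) <= q * mean P (trpow k) + p%:R * (kappa / N%:R).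
Proof.
set F := fun w => (1%:M + c%:C *: (th%:C *: psum k w)) ^+ N.
set Q := fun w => (1%:M + c%:C *: (th%:C *: Z k w)) ^+ N.
have F1 := rv_affine_pow (bdd_psum k); have Q1 := rv_affine_pow (ZG k).
have F2 : rvmx F by exact: rv_affine_pow (rv_psum k).
have Q2 : rvmx Q by exact: rv_affine_pow (rv_Z k).
have FQ : rvmx (fun w => F w *m Q w) by exact: mxinM.
have rtr (Y : T -> 'M[C]_p) : rvmx Y -> P.-integrable setT (EFin \o (fun w => Re (\tr (Y w)))).
  by move=> hY; exact: (bdd_Re_integrable (funalg_tr alg hY)).
have mtr (Y : T -> 'M[C]_p) : rvmx Y -> mean P (fun w => Re (\tr (Y w))) = Re (\tr (mxmean P Y)).
  by move=> hY; rewrite tr_mxmean.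
apply: (@le_trans _ _ (mean P (fun w => Re (\tr (F w *m Q w)) + p%:R * (kappa / N%:R)))).
  apply: ae_mean_le.
  - exact: (rtr _ (rv_affine_pow (rv_psum k.+1))).
  - rewrite (_ : EFin \o _ = fun w =>
        (Re (\tr (F w *m Q w) + (p%:R * (kappa / N%:R))%:C))%:E); last first.
      by apply/funext => w; rewrite ReD.
    exact: (bdd_Re_integrable (funalgD alg (funalg_tr alg FQ) (funalg_cst alg _))).
  - apply: filterS2 ZK (ZK' k) => w /(_ k) h1 h2.
    rewrite /trpow psumS scalerDr.
    by apply: golden_thompson_approx => //; rewrite adjZ (psum_adj, Zadj).
have icst (x : R) : P.-integrable setT (EFin \o (fun=> x)).
  exact: (bdd_Re_integrable (funalg_cst alg x%:C)).
rewrite meanD ?mean_cst ?lerD2r//; last exact: rtr.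
rewrite mtr// (mxmeanM (@past_measurable k) (@Gm k) (@ind k) F1 Q1).
have -> : mean P (trpow k) = Re (\tr (mxmean P F)) by rewrite -mtr.
have Fadj : (mxmean P F)^t* = mxmean P F.
  rewrite -mxmean_adj//; congr mxmean; apply/funext => w.
  by apply: affine_pow_adj; rewrite adjZ psum_adj.
have Fpsd : psd (mxmean P F).
  apply: psd_mxmean => //; apply: aeW => w.
  by apply: psd_affine_pow; rewrite ?adjZ ?psum_adj// /N expnS mul2n odd_double.
have := tr_mul_psd_ge0 Fadj Fpsd (mean_affine_pow_le k).
by rewrite mulmxBr mul_mx_scalar mxtraceD mxtraceN mxtraceZ ReB ReZ subr_ge0.
Qed.

Lemma mean_trpow_le k : (k <= n)%N ->
  mean P (trpow k) <= q ^+ k * (p%:R + k%:R * (p%:R * (kappa / N%:R))).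
Proof.
have q1 : 1 <= q by rewrite lerDl mulr_ge0// mulr_ge0// sqr_ge0.
have k0 : 0 <= p%:R * (kappa / N%:R).
  by rewrite mulr_ge0// divr_ge0// mulr_ge0 ?expR_ge0// mulr_ge0.
elim: k => [_|k IH kn].
  rewrite expr0 mul1r mul0r addr0 (_ : trpow 0 = fun=> p%:R) ?mean_cst//.
  apply/funext => w; rewrite /trpow /psum big_pred0_eq !scaler0 addr0 expr1n mxtrace1.
  by rewrite -[p%:R](rmorph_nat (real_complex R)).
have := trpow_step (Ordinal kn) => /= /le_trans; apply.
have q0 : 0 <= q by apply: le_trans q1.
apply: (@le_trans _ _ (q * (q ^+ k * (p%:R + k%:R * (p%:R * (kappa / N%:R)))) + p%:R * (kappa / N%:R))).
  by rewrite lerD2r ler_wpM2l// IH// ltnW.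
rewrite mulrA -exprS -natr1 mulrDl mul1r addrA [leRHS]mulrDr lerD2l.
by rewrite ler_peMl// exprn_ege1.
Qed.

End Step.

Lemma ae_rowbd_psum : exists2 K, 0 <= K &
  {ae P, forall w, (forall k, rowbd (psum k w) K) /\ (forall j, rowbd (Z j w) K)}.
Proof.
have h j : exists K : R, 0 <= K /\ {ae P, forall w, rowbd (Z j w) K}.
  have [K K0 hK] : exists2 K, 0 <= K & {ae P, forall w, rowbd (Z j w) K}.
    by apply: ae_rowbd => i l; have [] := ZG j i l.
  by exists K.
have [K hK] := choice h.
exists (\sum_j K j); first by apply: sumr_ge0 => j _; case: (hK j).
have : {ae P, forall w, forall j, rowbd (Z j w) (K j)}.
  by apply: filter_forall => j; case: (hK j).
apply: filterS => w hw; split=> [k|j]; last first.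
  apply: rowbdW (hw j); rewrite (bigD1 j)//= lerDl; apply: sumr_ge0 => l _.
  by case: (hK l).
apply: (@rowbdW _ _ _ (\sum_(i < n | (i < k)%N) K i)).
  rewrite [leRHS](bigID (fun i : 'I_n => (i < k)%N))/= lerDl.
  by apply: sumr_ge0 => l _; case: (hK l).
rewrite /psum; elim/big_rec2 : _ => [i|i x M _ IH]; last exact: rowbdD.
by rewrite big1// => j _; rewrite mxE Normc.normc0.
Qed.

(** Markov's inequality for [trpow], whose mean is at most [2 p q ^ n] once [N]
    is large, gives the tail [2 p exp (2 n th ^ 2 v - th s / 2)]. *)
Lemma ev_psum_tail (th s : R) : 0 < th -> th * V <= 2^-1 -> 0 <= s -> (0 < p)%N ->
  exists E : set T, [/\ measurable E,
    ((1 - 2 * p%:R * expR (2 * n%:R * th ^+ 2 * v - th * s / 2))%:E <= P E)%E &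
    forall w, E w -> forall i, ev (\sum_j Z j w) i <= s].
Proof.
move=> th0 thV s0 p0; have [K K0 hK] := ae_rowbd_psum.
have tK0 : 0 <= th * K by rewrite mulr_ge0// ltW.
have nth : `|th| = th by rewrite gtr0_norm.
have ZK : {ae P, forall w, forall k, rowbd (th%:C *: psum k w) (th * K)}.
  by apply: filterS hK => w [h _] k; rewrite -nth; have := rowbdZ th (h k); rewrite nth.
have ZK' j : {ae P, forall w, rowbd (th%:C *: Z j w) (th * K)}.
  by apply: filterS hK => w [_ h]; have := rowbdZ th (h j); rewrite nth.
set kap := expR (th * K + th * K) * (th * K * (th * K)).
have kap0 : 0 <= kap by rewrite mulr_ge0 ?expR_ge0// mulr_ge0.
(* N >= th s makes (1 + th s / N) ^ N exceed exp (th s / 2), and N >= n kap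
   absorbs the n Golden-Thompson errors into the initial value p. *)
pose e := Num.trunc (th * s + n%:R * kap).
pose N := (2 ^ e.+1)%N.
have N0 : 0 < N%:R :> R by rewrite ltr0n expn_gt0.
have eN : th * s + n%:R * kap <= N%:R.
  apply: le_trans (ltW (truncnS_gt _)) _; rewrite ler_nat.
  exact: (ltnW (ltn_expl e.+1 (ltnSn 1))).
have ts0 : 0 <= th * s by rewrite mulr_ge0// ltW.
have nk0 : 0 <= n%:R * kap by rewrite mulr_ge0.
have sN : th * s <= N%:R by apply: le_trans eN; rewrite lerDl.
have kN : n%:R * kap <= N%:R by apply: le_trans eN; rewrite lerDr.
have := @mean_trpow_le th (th * K) th0 thV tK0 ZK ZK' e n (leqnn n).
rewrite -/N -/kap; set q := 1 + _; set f := trpow _ _ _ => mf.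
have mf2 : mean P f <= 2 * p%:R * expR (2 * n%:R * th ^+ 2 * v).
  apply: le_trans mf _; rewrite [leRHS]mulrC; apply: ler_pM.
  - by rewrite exprn_ge0// addr_ge0// mulr_ge0// mulr_ge0// sqr_ge0.
  - by rewrite addr_ge0// mulr_ge0// mulr_ge0// divr_ge0// ltW.
  - rewrite (_ : 2 * _ * _ * _ = n%:R * (2 * th ^+ 2 * v)); last by ring.
    by apply: onePpow_le_expR; rewrite mulr_ge0// mulr_ge0// sqr_ge0.
  - rewrite mulrDl mul1r lerD2l mulrCA mulrA -mulrA ler_piMr//.
    by rewrite mulrA ler_pdivrMr// mul1r.
pose a := (1 + N%:R^-1 * (th * s)) ^+ N.
have ha : expR (th * s / 2) <= a by apply: affine_pow_ge_expR; rewrite // expn_gt0.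
have a0 : 0 < a by apply: lt_le_trans ha; rewrite expR_gt0.
pose bad := [set w | a < f w].
have rF : rvmx (fun w => (1%:M + (N%:R^-1)%:C *: (th%:C *: psum n w)) ^+ N).
  exact: (rv_affine_pow _ _ (rv_psum n)).
have mfun : measurable_fun setT f.
  by have /(funalg_tr alg) [[h _] _] := rF; exact: measurable_gen.
have mbad : measurable bad.
  rewrite [X in measurable X](_ : bad = f @^-1` `]a, +oo[%classic).
    by rewrite -[X in measurable X]setTI; exact: mfun.
  by apply/seteqP; split=> w /=; rewrite in_itv/= andbT.
have Pbad : (P bad <= (2 * p%:R * expR (2 * n%:R * th ^+ 2 * v - th * s / 2))%:E)%E.
  have fin : P bad \is a fin_num by exact: fin_num_measure.
  rewrite -(fineK fin) lee_fin.
  have i1 : P.-integrable setT (EFin \o (\1_bad : T -> R)) by exact: integrable_indic.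
  have m1 : mean P (\1_bad : T -> R) = fine (P bad).
    by rewrite meanE integral_indic// setIT.
  have i2 : P.-integrable setT (EFin \o (fun w => a * (\1_bad w : R))).
    by have := integrableZl measurableT a i1.
  have : mean P (fun w => a * (\1_bad w : R)) <= mean P f.
    apply: ae_mean_le => //; first exact: (bdd_Re_integrable (funalg_tr alg rF)).
    apply: aeW => w; rewrite indicE; case: (boolP (w \in bad)) => [/set_mem/ltW|_].
      by rewrite mulr1.
    rewrite mulr0; apply: psd_tr_ge0; apply: psd_affine_pow.
      by rewrite adjZ psum_adj.
    by rewrite expnS mul2n odd_double.
  rewrite meanZ// m1 => h.
  have h2 := le_trans h mf2.
  have P0 : 0 <= fine (P bad) by rewrite fine_ge0.
  rewrite expRD expRN mulrA ler_pdivlMr ?expR_gt0//.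
  by apply: le_trans h2; rewrite mulrC ler_wpM2r.
exists (~` bad); split; first exact: measurableC.
  by rewrite probability_setC// EFinB leeB.
move=> w /negP; rewrite -leNgt => fa i.
have -> : \sum_j Z j w = psum n w by rewrite /psum; apply: eq_bigl => j; rewrite ltn_ord.
apply: (ev_le_affine_pow (c := N%:R^-1 * th) (N := N)) => //.
- exact: psum_adj.
- by rewrite /N expnS mul2n odd_double.
- by rewrite expn_gt0.
- by rewrite mulr_gt0// invr_gt0.
- by rewrite rmorphM /= -scalerA -mulrA.
Qed.

(** With [D = sqrt (n v tau) + V tau] and [th = tau / (2 D)], the variance term
    [2 n th ^ 2 v] is at most [tau / 2] and [th s / 2 = 3 tau / 2] for [s = 6 D]. *)
Lemma ev_psum_bernstein (tau : R) : 0 < tau -> (0 < p)%N ->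
  exists E : set T, [/\ measurable E,
    ((1 - 2 * p%:R * expR (- tau))%:E <= P E)%E &
    forall w, E w -> forall i,
      ev (\sum_j Z j w) i <= 6 * (Num.sqrt (n%:R * v * tau) + V * tau)].
Proof.
move=> tau0 p0; set D := Num.sqrt _ + _.
have Vt : 0 < V * tau by rewrite mulr_gt0.
have sq0 : 0 <= Num.sqrt (n%:R * v * tau) := sqrtr_ge0 _.
have D0 : 0 < D by rewrite /D; lra.
have nvt : n%:R * v * tau <= D ^+ 2.
  rewrite -[leLHS]sqr_sqrtr; last by rewrite !mulr_ge0// ltW.
  by rewrite lerXn2r ?nnegrE// /D ?addr_ge0// ?lerDl ltW.
pose th := tau / (2 * D).
have th0 : 0 < th by rewrite divr_gt0// mulr_gt0.
have thV : th * V <= 2^-1.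
  rewrite /th mulrAC ler_pdivrMr ?mulr_gt0// mulrA mulVf// mul1r mulrC.
  by rewrite /D lerDr.
have s0 : 0 <= 6 * D by rewrite mulr_ge0// ltW.
have [E [mE PE hE]] := ev_psum_tail th0 thV s0 p0.
exists E; split=> //; apply: le_trans PE; rewrite lee_fin lerB// ler_wpM2l ?mulr_ge0//.
rewrite ler_expR.
have e1 : th * (6 * D) / 2 = 3 * tau / 2.
  by rewrite /th; field; rewrite gt_eqF.
have e2 : 2 * n%:R * th ^+ 2 * v <= tau / 2.
  have -> : 2 * n%:R * th ^+ 2 * v = tau / 2 * (n%:R * v * tau / D ^+ 2).
    by rewrite /th; field; rewrite gt_eqF.
  rewrite -[leRHS]mulr1; apply: ler_wpM2l; first by rewrite divr_ge0// ltW.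
  by rewrite ler_pdivrMr ?mul1r// exprn_gt0.
by rewrite e1; lra.
Qed.

End Bernstein.

(** The upper tail [ev_psum_bernstein] applies to the [Z j] and to the [- Z j]. *)
Theorem matrix_bernstein {R : realType} {d : measure_display} {T : measurableType d}
    (P : probability T R) (p n : nat) (Z : 'I_n -> T -> 'M[R[i]]_p)
    (G : 'I_n -> set (set T)) (V v tau : R) :
  (forall i, G i `<=` measurable) ->
  (forall k : 'I_n, independent P <<s past G k >> <<s G k >>) ->
  (forall j, mxin (bdd P (G j)) (Z j)) ->
  (forall j w, (Z j w)^t* = Z j w) ->
  (forall j, {ae P, forall w, mxbound V (Z j w)}) ->
  (forall j, mxmean P (Z j) = 0) ->
  (forall j, psd (v%:C%:M - mxmean P (fun w => Z j w *m Z j w))) ->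
  0 < V -> 0 <= v -> 0 < tau -> (0 < p)%N ->
  exists E : set T, [/\ measurable E,
    ((1 - 4 * p%:R * expR (- tau))%:E <= P E)%E &
    forall w, E w ->
      mxbound (6 * (Num.sqrt (n%:R * v * tau) + V * tau)) (\sum_j Z j w)].
Proof.
move=> Gm ind ZG Zadj ZV Z0 Zv V0 v0 tau0 p0.
have [E [mE PE hE]] := ev_psum_bernstein Gm ind ZG Zadj ZV Z0 Zv V0 v0 tau0 p0.
pose Y j w := - Z j w.
have YG j : mxin (bdd P (G j)) (Y j) by apply: mxinN (ZG j); exact: funalg_bdd.
have Yadj j w : (Y j w)^t* = Y j w by rewrite /Y adjN Zadj.
have YV j : {ae P, forall w, mxbound V (Y j w)}.
  by apply: filterS (ZV j) => w [h1 h2]; split; rewrite /Y ?opprK.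
have Y0 j : mxmean P (Y j) = 0.
  rewrite /Y mxmeanN ?Z0 ?oppr0//; apply: mxin_bddS (ZG j).
  exact: sub_gen_measurable (@Gm j).
have Yv j : psd (v%:C%:M - mxmean P (fun w => Y j w *m Y j w)).
  rewrite (_ : (fun w => _) = fun w => Z j w *m Z j w)//.
  by apply/funext => w; rewrite /Y mulNmx mulmxN opprK.
have [F [mF PF hF]] := ev_psum_bernstein Gm ind YG Yadj YV Y0 Yv V0 v0 tau0 p0.
exists (E `&` F); split; first exact: measurableI.
  have fP (A : set T) : measurable A -> P A = (fine (P A))%:E.
    by move=> mA; rewrite fineK// fin_num_measure.
  have mEc := measurableC mE; have mFc := measurableC mF.
  have : (P (~` (E `&` F)) <= P (~` E) + P (~` F))%E.
    by rewrite setCI; exact: measureU2.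
  rewrite !probability_setC//; last exact: measurableI.
  move: PE PF; rewrite (fP _ mE) (fP _ mF) (fP _ (measurableI _ _ mE mF)).
  rewrite -!EFinB -EFinD !lee_fin; lra.
move=> w [/hE h1 /hF h2].
have Sadj : (\sum_j Z j w)^t* = \sum_j Z j w.
  elim/big_rec : _ => [|i M _ IH]; first by rewrite trmx0 map_mx0.
  by rewrite adjD Zadj IH.
have eY : \sum_j Y j w = - \sum_j Z j w by rewrite sumrN.
set s := 6 * _ in h1 h2 *; split.
  have -> : s%:C%:M - \sum_j Z j w = mxfun (fun x => s + -1 * x) (\sum_j Z j w).
    by rewrite mxfunD mxfun_cst mxfunZ mxfun_id// rmorphN1 scaleN1r.
  by apply/psd_mxfunP => i; have := h1 i; lra.
have Yadj' : (\sum_j Y j w)^t* = \sum_j Y j w by rewrite eY adjN Sadj.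
have -> : s%:C%:M + \sum_j Z j w = mxfun (fun x => s + -1 * x) (\sum_j Y j w).
  by rewrite mxfunD mxfun_cst mxfunZ mxfun_id// rmorphN1 scaleN1r eY opprK.
by apply/psd_mxfunP => i; have := h2 i; lra.
Qed.

(** * Independence of blocks *)

Section Blocks.
Context {R : realType} {d : measure_display} {T : measurableType d}.
Variable P : probability T R.

Lemma independentS (F G F' G' : set (set T)) : F `<=` F' -> G `<=` G' ->
  independent P F' G' -> independent P F G.
Proof. by move=> FF GG ind A B /FF FA /GG GB; exact: ind. Qed.

Lemma independentC (F G : set (set T)) : independent P F G -> independent P G F.
Proof. by move=> ind A B GA FB; rewrite setIC muleC ind. Qed.

(** For fixed [B], the finite measures [P (. `&` B)] and [P B * P] agree on the
    sigma-algebra generated by a pi-system on which they agree. *)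
Lemma independent_gen_l (F G : set (set T)) : F `<=` measurable -> G `<=` measurable ->
  setI_closed F -> F setT -> independent P F G -> independent P <<s F >> G.
Proof.
move=> Fm Gm FI FT ind A B sFA GB.
have mB : measurable B by exact: Gm.
have PB0 : 0 <= fine (P B) by rewrite fine_ge0.
have PBE : P B = (fine (P B))%:E by rewrite fineK// fin_num_measure.
pose m1 := mrestr P mB.
pose m2 := mscale (NngNum PB0) P.
have m2E A' : m2 A' = (P B * P A')%E by rewrite [in RHS]PBE.
have h : forall E, <<s F >> E -> m1 E = m2 E.
  apply: (g_sigma_algebra_measure_unique F Fm (fun=> setT)) => //.
  - by rewrite bigcup_const//; exists 0%N.
  - move=> E FE; apply: etrans (esym (m2E E)); rewrite muleC.
    exact: ind.
  - move=> _; have : (m1 setT < +oo)%E by rewrite /m1 /mrestr setTI PBE ltry.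
    exact.
by rewrite muleC -m2E; exact: h.
Qed.

Lemma independent_gen (F G : set (set T)) : F `<=` measurable -> G `<=` measurable ->
  setI_closed F -> setI_closed G -> F setT -> G setT ->
  independent P F G -> independent P <<s F >> <<s G >>.
Proof.
move=> Fm Gm FI GI FT GT ind.
have sFm : <<s F >> `<=` measurable.
  exact: smallest_sub (@sigma_algebra_measurable _ T) Fm.
apply: independentC; apply: independent_gen_l => //; apply: independentC.
exact: independent_gen_l.
Qed.

Variables (I : finType) (FX FY : I -> set (set T)).
Hypothesis FXm : forall i, FX i `<=` measurable.
Hypothesis FYm : forall i, FY i `<=` measurable.
Hypothesis FXI : forall i, setI_closed (FX i).
Hypothesis FYI : forall i, setI_closed (FY i).
Hypothesis FXT : forall i, FX i setT.
Hypothesis FYT : forall i, FY i setT.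
Hypothesis indX : mutually_independent P FX.
Hypothesis indY : mutually_independent P FY.
Hypothesis indXY : independent P <<s \bigcup_i FX i >> <<s \bigcup_i FY i >>.

Definition block (J : {set I}) : set (set T) := \bigcup_(i in [set` J]) (FX i `|` FY i).

(** The finite intersections of events of the single variables form a pi-system
    that generates the block, and their probabilities are products. *)
Definition rects (J : {set I}) : set (set T) :=
  [set E | exists A B : I -> set T, [/\ forall i, FX i (A i), forall i, FY i (B i) &
     E = \bigcap_(i in [set` J]) (A i `&` B i)]].

Lemma bigcap_gen (F : I -> set (set T)) (J : {set I}) (A : I -> set T) :
  (forall i, F i (A i)) -> <<s \bigcup_i F i >> (\bigcap_(i in [set` J]) A i).
Proof.
move=> FA.
apply: (@fin_bigcap_measurable _ (g_sigma_algebraType (\bigcup_i F i))) => [|i _].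
  exact: finite_finset.
by apply: sub_sigma_algebra; exists i.
Qed.

Lemma prob_rect (J : {set I}) A B : (forall i, FX i (A i)) -> (forall i, FY i (B i)) ->
  (P (\bigcap_(i in [set` J]) (A i `&` B i)) = \prod_(i in J) (P (A i) * P (B i)))%E.
Proof.
move=> FA FB.
have -> : \bigcap_(i in [set` J]) (A i `&` B i) =
    \bigcap_(i in [set` J]) A i `&` \bigcap_(i in [set` J]) B i.
  by rewrite bigcapI.
rewrite indXY; try exact: bigcap_gen.
rewrite indX// indY//.
have e (F : I -> set T) : (forall i, measurable (F i)) ->
    (\prod_(i in J) P (F i) = (\prod_(i in J) fine (P (F i)))%:E)%E.
  move=> mF; elim/big_rec2 : _ => [//|i x y _ IH].
  by rewrite EFinM -IH fineK// fin_num_measure.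
rewrite !e; [|by move=> i; exact: (FYm (FB i))|by move=> i; exact: (FXm (FA i))].
rewrite -EFinM -big_split /=; elim/big_rec2 : _ => [//|i x y _ IH].
rewrite !EFinM IH !fineK ?fin_num_measure//; first exact: (FYm (FB i)).
exact: (FXm (FA i)).
Qed.

Lemma rects_measurable J : rects J `<=` measurable.
Proof.
move=> E [A [B [FA FB ->]]]; apply: fin_bigcap_measurable => [|i _].
  exact: finite_finset.
by apply: measurableI; [exact: (FXm (FA i))|exact: (FYm (FB i))].
Qed.

Lemma rects_setI J : setI_closed (rects J).
Proof.
move=> E F [A [B [FA FB ->]]] [A' [B' [FA' FB' ->]]].
exists (fun i => A i `&` A' i), (fun i => B i `&` B' i); split.
- by move=> i; exact: FXI.
- by move=> i; exact: FYI.
- rewrite -bigcapI; apply: eq_bigcapr => i _.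
  by rewrite setIACA.
Qed.

Lemma rects_setT J : rects J setT.
Proof.
exists (fun=> setT), (fun=> setT); split=> //.
by apply/seteqP; split.
Qed.

Lemma rects_independent (J K : {set I}) : fintype.disjoint (mem J) (mem K) ->
  independent P (rects J) (rects K).
Proof.
move=> JK E F [A [B [FA FB ->]]] [A' [B' [FA' FB' ->]]].
pose A2 i := if i \in J then A i else A' i.
pose B2 i := if i \in J then B i else B' i.
have FA2 i : FX i (A2 i) by rewrite /A2; case: ifP.
have FB2 i : FY i (B2 i) by rewrite /B2; case: ifP.
have eJ i : i \in J -> A2 i `&` B2 i = A i `&` B i by rewrite /A2 /B2 => ->.
have eK i : i \in K -> A2 i `&` B2 i = A' i `&` B' i.
  by rewrite /A2 /B2 => iK; rewrite (disjointFl JK iK).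
have -> : \bigcap_(i in [set` J]) (A i `&` B i) `&` \bigcap_(i in [set` K]) (A' i `&` B' i)
    = \bigcap_(i in [set` (J :|: K)%SET]) (A2 i `&` B2 i).
  apply/seteqP; split=> w.
    move=> [h1 h2] i; rewrite [X in X -> _]/= inE => /orP[iJ|iK]; first by rewrite eJ//; exact: h1.
    by rewrite eK//; exact: h2.
  move=> h; split=> i iJ.
    by rewrite -eJ//; apply: h; rewrite /= inE; apply/orP; left.
  by rewrite -eK//; apply: h; rewrite /= inE; apply/orP; right.
rewrite !prob_rect// (eq_bigl _ _ (fun i => finset.in_setU i J K)) bigU//=; congr (_ * _)%E.
  by apply: eq_bigr => i iJ; rewrite /A2 /B2 iJ.
by apply: eq_bigr => i iK; rewrite /A2 /B2 (disjointFl JK iK).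
Qed.

Lemma sub_block_rects J : <<s block J >> `<=` <<s rects J >>.
Proof.
apply: sub_sigma_algebra2 => E [i /= iJ [FE|FE]].
  exists (fun k => if k == i then E else setT), (fun=> setT); split=> //.
    by move=> k; case: eqVneq => [->|_].
  apply/seteqP; split=> w; first by move=> Ew k _; split=> //; case: eqVneq.
  by move=> /(_ i iJ) []; rewrite eqxx.
exists (fun=> setT), (fun k => if k == i then E else setT); split=> //.
  by move=> k; case: eqVneq => [->|_].
apply/seteqP; split=> w; first by move=> Ew k _; split=> //; case: eqVneq.
by move=> /(_ i iJ) []; rewrite eqxx.
Qed.

Lemma independent_blocks (J K : {set I}) : fintype.disjoint (mem J) (mem K) ->
  independent P <<s block J >> <<s block K >>.
Proof.
move=> JK; apply: (independentS (@sub_block_rects J) (@sub_block_rects K)).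
apply: independent_gen.
- exact: rects_measurable.
- exact: rects_measurable.
- exact: rects_setI.
- exact: rects_setI.
- exact: rects_setT.
- exact: rects_setT.
- exact: rects_independent.
Qed.

End Blocks.

(** * Identically distributed matrices *)

Section SameLaw.
Context {R : realType} {d : measure_display} {T : measurableType d}.
Variable P : probability T R.
Local Notation C := R[i].

Lemma mean_same_law (f g : T -> R) :
  measurable_fun setT f -> measurable_fun setT g ->
  P.-integrable setT (EFin \o f) -> P.-integrable setT (EFin \o g) ->
  (forall B, measurable B -> P (f @^-1` B) = P (g @^-1` B)) ->
  mean P f = mean P g.
Proof.
move=> mf mg intf intg h; rewrite !meanE; congr fine.
pose f' : {mfun T >-> R} := mfun_Sub (mem_set mf).
pose g' : {mfun T >-> R} := mfun_Sub (mem_set mg).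
have -> : (\int[P]_w (f w)%:E = \int[distribution P f']_x x%:E)%E.
  by rewrite integral_distribution.
have -> : (\int[P]_w (g w)%:E = \int[distribution P g']_x x%:E)%E.
  by rewrite integral_distribution.
by apply: eq_measure_integral => A mA _; exact: h.
Qed.

Lemma sigma_algebra_mx_borel m : <<s @mx_borel R m >> = mx_borel m.
Proof. exact/sigma_algebra_id/smallest_sigma_algebra. Qed.

Lemma mfun_entries m : mxin (mfun_C (@mx_borel R m)) (fun M : 'M[C]_m => M).
Proof.
move=> i j; split=> _ B mB; rewrite setTI /measurable /= sigma_algebra_mx_borel;
  apply: sub_sigma_algebra; exists i, j, B; split=> //; [left|right]; by [].
Qed.

Lemma mx_borel_preimage m (f : 'M[C]_m -> R) B : 
  measurable_fun setT (f : g_sigma_algebraType (@mx_borel R m) -> R) ->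
  measurable B -> mx_borel m (f @^-1` B).
Proof.
move=> mf mB; have := mf measurableT B mB.
by rewrite setTI /measurable /= sigma_algebra_mx_borel.
Qed.

Lemma mxmean_same_law m p q (Z Z' : T -> 'M[C]_m) (F : 'M[C]_m -> 'M[C]_(p, q)) :
  same_law P (mx_borel m) Z Z' -> mxin (mfun_C (@mx_borel R m)) F ->
  mxin (bdd P measurable) (fun w => F (Z w)) ->
  mxin (bdd P measurable) (fun w => F (Z' w)) ->
  mxmean P (fun w => F (Z w)) = mxmean P (fun w => F (Z' w)).
Proof.
move=> law mF hZ hZ'; apply/matrixP => i j; rewrite !mxE.
have [[m1 m2] _] := hZ i j; have [[m1' m2'] _] := hZ' i j.
have [f1 f2] := mF i j.
congr (_ +i* _); apply: mean_same_law.
- exact: measurable_gen.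
- exact: measurable_gen.
- exact: (bdd_Re_integrable (hZ i j)).
- exact: (bdd_Re_integrable (hZ' i j)).
- by move=> B mB; exact: (law _ (mx_borel_preimage f1 mB)).
- exact: measurable_gen.
- exact: measurable_gen.
- exact: (bdd_Im_integrable (hZ i j)).
- exact: (bdd_Im_integrable (hZ' i j)).
- by move=> B mB; exact: (law _ (mx_borel_preimage f2 mB)).
Qed.

Lemma ae_same_law V (G : set (set V)) (Z Z' : T -> V) (B : set V) :
  same_law P G Z Z' -> G (~` B) -> measurable (Z @^-1` (~` B)) ->
  measurable (Z' @^-1` (~` B)) ->
  {ae P, forall w, B (Z w)} -> {ae P, forall w, B (Z' w)}.
Proof.
move=> law GB mZ mZ' h.
apply/negligibleP; first exact: mZ'.
by rewrite -[LHS](law _ GB); apply/negligibleP.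
Qed.

End SameLaw.

(** * The observations *)

Section Observations.
Context {R : realType} {d : measure_display} {T : measurableType d}.
Variable P : probability T R.
Local Notation C := R[i].
Local Notation rvmx := (mxin (bdd P measurable)).
Variables (m n : nat) (X : T -> 'M[C]_m) (Xs : 'I_n -> T -> 'M[C]_m).
Variables (xi : T -> R) (xis : 'I_n -> T -> R) (U c_xi : R).
Hypothesis model : sampling_model P X Xs xi xis.
Hypothesis U0 : 0 < U.
Hypothesis c0 : 0 < c_xi.
Hypothesis XU : {ae P, forall w, opnorm (X w) <= U}.
Hypothesis xic : {ae P, forall w, `|xi w| <= c_xi}.

Let alg := funalg_bdd P measurable.

Local Notation X_ o := (with_copy X Xs o).
Local Notation xi_ o := (with_copy xi xis o).
Local Notation FX o := (events_of (mx_borel m) (X_ o)).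
Local Notation FY o := (events_of measurable (xi_ o)).

Lemma events_measurable_X o : FX o `<=` measurable.
Proof. exact: (model_mxrv model). Qed.

Lemma events_measurable_xi o : FY o `<=` measurable.
Proof.
by move=> _ [B mB <-]; have := model_rv model o measurableT mB; rewrite setTI.
Qed.

Lemma events_setI V (H : set (set V)) (Y : T -> V) : setI_closed H ->
  setI_closed (events_of H Y).
Proof.
move=> HI _ _ [A HA <-] [B HB <-]; exists (A `&` B); first exact: HI.
by rewrite preimage_setI.
Qed.

Lemma mx_borel_setI : setI_closed (@mx_borel R m).
Proof.
move=> A B; rewrite -sigma_algebra_mx_borel.
exact: (@measurableI _ (g_sigma_algebraType (@mx_borel R m))).
Qed.

Lemma mx_borelT : mx_borel m [set: 'M[C]_m].
Proof.
rewrite -sigma_algebra_mx_borel.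
exact: (@measurableT _ (g_sigma_algebraType (@mx_borel R m))).
Qed.

Lemma X_law o : same_law P (mx_borel m) X (X_ o).
Proof. by case: (model_iid_X model) => _ /(_ None o). Qed.

Lemma xi_law o : same_law P measurable xi (xi_ o).
Proof. by case: (model_iid_xi model) => _ /(_ None o). Qed.

Lemma X_adj o w : (X_ o w)^t* = X_ o w.
Proof. exact/hermP/(model_herm model). Qed.

(** Almost sure bounds pass from [X] to its copies only through events in
    [mx_borel]. The bound on the operator norm is one of these, being
    equivalent to the inequalities [tr (X ^ (2 k)) <= m U ^ (2 k)]. *)
Lemma X_ev o : {ae P, forall w, forall i, `|ev (X_ o w) i| <= U}.
Proof.
pose B k : set 'M[C]_m := [set M | Re (\tr (M ^+ k.*2)) <= m%:R * U ^+ k.*2].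
have algm := @funalg_mfun R 'M[C]_m (mx_borel m).
have mB k : mx_borel m (~` B k).
  have [mtr _] := funalg_tr algm (mxinX algm k.*2 (@mfun_entries R m)).
  have := mx_borel_preimage mtr (measurable_itv `]m%:R * U ^+ k.*2, +oo[).
  congr (mx_borel m _); apply/seteqP; split=> M /=; rewrite in_itv/= andbT.
    by rewrite ltNge => /negP.
  by rewrite ltNge => /negP.
have hX : {ae P, forall w, forall k, B k (X w)}.
  apply: filterS XU => w hw k.
  apply: (ev_norm_le_trP (X_adj None w) U0).1 => i.
  apply: le_trans hw; have := ev_mxfun_opnorm idfun (X w) i.
  by rewrite mxfun_id// (X_adj None w).
have : {ae P, forall w, forall k, B k (X_ o w)}.
  apply: ae_foralln => k; apply: (ae_same_law (X_law o) (mB k)).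
  - by apply: (@events_measurable_X None); exists (~` B k).
  - by apply: (@events_measurable_X o); exists (~` B k).
  - by apply: filterS hX => w.
apply: filterS => w hw; apply: (ev_norm_le_trP (X_adj o w) U0).2 => k.
exact: hw.
Qed.

Lemma xi_bound o : {ae P, forall w, `|xi_ o w| <= c_xi}.
Proof.
have mB : measurable (~` [set x : R | `|x| <= c_xi]).
  apply: measurableC; rewrite (_ : [set x | _] = `[- c_xi, c_xi]%classic).
    exact: measurable_itv.
  by apply/seteqP; split=> x /=; rewrite in_itv/= ler_norml.
apply: (@ae_same_law _ _ _ P _ measurable xi (xi_ o) [set x : R | `|x| <= c_xi]) => //.
- exact: xi_law.
- by apply: (@events_measurable_xi None); exists (~` [set x : R | `|x| <= c_xi]).
- by apply: (@events_measurable_xi o); exists (~` [set x : R | `|x| <= c_xi]).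
Qed.

Lemma bdd_X o : mxin (bdd P (FX o)) (X_ o).
Proof.
move=> i j; split.
  have [e1 e2] := @mfun_entries R m i j.
  split=> _ B mB; rewrite setTI; apply: sub_sigma_algebra.
    by exists ((fun M : 'M[C]_m => Re (M i j)) @^-1` B) => //; exact: mx_borel_preimage.
  by exists ((fun M : 'M[C]_m => Im (M i j)) @^-1` B) => //; exact: mx_borel_preimage.
exists (Num.sqrt (m%:R * U ^+ 2)); apply: filterS (X_ev o) => w h.
have hf : frob (X_ o w) <= m%:R * U ^+ 2.
  rewrite /frob X_adj -[_ *m _]/(_ * _) -expr2.
  exact: ((ev_norm_le_trP (X_adj o w) U0).1 h 1%N).
rewrite frobE in hf.
rewrite -[leLHS]ger0_norm ?nc_ge0// -sqrtr_sqr ler_wsqrtr//; apply: le_trans hf.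
rewrite (bigD1 i)//= (bigD1 j)//= -addrA lerDl addr_ge0//.
  by apply: sumr_ge0 => k _; rewrite sqr_ge0.
by apply: sumr_ge0 => k _; apply: sumr_ge0 => l _; rewrite sqr_ge0.
Qed.

Lemma rv_X o : rvmx (X_ o).
Proof.
by apply: mxin_bddS (bdd_X o); apply: sub_gen_measurable; exact: events_measurable_X.
Qed.

Lemma bdd_xi o : bdd P (FY o) (fun w => (xi_ o w)%:C).
Proof.
split; last by exists c_xi; apply: filterS (xi_bound o) => w; rewrite nc_real.
split; last exact: measurable_cst.
by move=> _ B mB; rewrite setTI; apply: sub_sigma_algebra; exists B.
Qed.

Definition obs (j : 'I_n) : set (set T) := FX (Some j) `|` FY (Some j).

Lemma obs_measurable j : obs j `<=` measurable.
Proof.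
by move=> A [hA|hA]; [exact: events_measurable_X hA|exact: events_measurable_xi hA].
Qed.

Lemma obs_independent (k : 'I_n) : independent P <<s past obs k >> <<s obs k >>.
Proof.
pose J : {set option 'I_n} := finset.finset (fun o : option 'I_n => if o is Some i then (i < k)%N else false).
pose K : {set option 'I_n} := finset.set1 (Some k).
have JK : fintype.disjoint (mem J) (mem K).
  apply/pred0P => o /=; rewrite !inE; apply/negP => /andP[+ /eqP oE].
  by rewrite oE ltnn.
apply: independentS (@independent_blocks R d T P (option 'I_n) (fun o => FX o)
  (fun o => FY o) _ _ _ _ _ _ _ _ _ J K JK).
- apply: sub_sigma_algebra2 => A [i /= ik obsA]; exists (Some i) => //=.
  by rewrite inE.
- apply: sub_sigma_algebra2 => A obsA; exists (Some k) => //=.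
  by rewrite inE.
- exact: events_measurable_X.
- exact: events_measurable_xi.
- by move=> o; apply: events_setI; exact: mx_borel_setI.
- by move=> o; apply: events_setI; exact: measurableI.
- by move=> o; exists setT; [exact: mx_borelT|exact: preimage_setT].
- by move=> o; exists setT; [exact: measurableT|exact: preimage_setT].
- exact: (model_iid_X model).1.
- exact: (model_iid_xi model).1.
- exact: (model_indep model).
Qed.

Lemma X_xi_independent o : independent P <<s FX o >> <<s FY o >>.
Proof.
apply: independentS (model_indep model); apply: sub_sigma_algebra2 => A hA.
  by exists o.
by exists o.
Qed.

(** ** The noise term *)

Definition noise j w : 'M[C]_m := (xis j w)%:C *: Xs j w.

Lemma noiseE j : noise j = fun w => ((xis j w)%:C)%:M *m Xs j w.
Proof. by apply/funext => w; rewrite mul_scalar_mx. Qed.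

Lemma obs_X j : mxin (bdd P (obs j)) (Xs j).
Proof.
apply: mxin_bddS (bdd_X (Some j)); apply: sub_sigma_algebra2 => A hA.
by left.
Qed.

Lemma obs_xi j : bdd P (obs j) (fun w => (xis j w)%:C).
Proof.
by apply: bddS (bdd_xi (Some j)); apply: sub_sigma_algebra2 => A hA; right.
Qed.

Lemma bdd_noise j : mxin (bdd P (obs j)) (noise j).
Proof.
rewrite noiseE; have aj := funalg_bdd P (obs j).
exact: (mxinM aj (mxin_scalar aj (obs_xi j)) (obs_X j)).
Qed.

Lemma noise_adj j w : (noise j w)^t* = noise j w.
Proof. by rewrite adjZ (X_adj (Some j)). Qed.

Lemma noise_bound j : {ae P, forall w, mxbound (c_xi * U) (noise j w)}.
Proof.
apply: filterS2 (X_ev (Some j)) (xi_bound (Some j)) => w hX hxi.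
have bd i : `|xis j w * ev (Xs j w) i| <= c_xi * U.
  by rewrite normrM ler_pM// hX.
have hA := X_adj (Some j) w; rewrite /= in hA.
split.
  have -> : (c_xi * U)%:C%:M - noise j w =
      mxfun (fun x => c_xi * U + (- xis j w) * idfun x) (Xs j w).
    by rewrite mxfunD mxfun_cst mxfunZ mxfun_id// rmorphN scaleNr.
  by apply/psd_mxfunP => i; have := bd i; rewrite ler_norml /= mulNr subr_ge0 => /andP[].
have -> : (c_xi * U)%:C%:M + noise j w =
    mxfun (fun x => c_xi * U + xis j w * idfun x) (Xs j w).
  by rewrite mxfunD mxfun_cst mxfunZ mxfun_id.
by apply/psd_mxfunP => i; have := bd i; rewrite ler_norml -lerBlDl sub0r => /andP[].
Qed.

Lemma rv_xi o : bdd P measurable (fun w => (xi_ o w)%:C).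
Proof.
by apply: bddS (bdd_xi o); apply: sub_gen_measurable; exact: events_measurable_xi.
Qed.

Lemma cmean_real (f : T -> R) : cmean P (fun w => (f w)%:C) = (mean P f)%:C.
Proof. by rewrite /cmean /= mean_cst. Qed.

Lemma mxmean_scalar (f : T -> C) : bdd P measurable f ->
  mxmean P (fun w => (f w)%:M : 'M[C]_m) = (cmean P f)%:M.
Proof.
move=> hf; transitivity (cmean P f *: (1%:M : 'M[C]_m)); last by rewrite scalemx1.
apply/matrixP => i j; rewrite !mxE -/(cmean P _); case: (eqVneq i j) => [->|ij].
  by rewrite mulr1; congr cmean; apply/funext => w; rewrite mxE eqxx mulr1n.
rewrite mulr0 -(cmean_cst P 0); congr cmean; apply/funext => w.
by rewrite mxE (negPf ij).
Qed.

Lemma integrable_xi o : P.-integrable setT (EFin \o xi_ o).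
Proof. exact: (bdd_Re_integrable (rv_xi o)). Qed.

Lemma mean_xi o : mean P (xi_ o) = 0.
Proof.
have e : mean P xi = 0 by rewrite /mean (model_mean model).
rewrite -e; apply/esym/mean_same_law.
- exact: (model_rv model None).
- exact: (model_rv model).
- exact: (integrable_xi None).
- exact: integrable_xi.
- by move=> B mB; exact: xi_law.
Qed.

Lemma mean_noise j : mxmean P (noise j) = 0.
Proof.
have aY := funalg_bdd P (FY (Some j)).
rewrite noiseE (mxmeanM (@events_measurable_xi (Some j)) (@events_measurable_X (Some j))
  (independentC (@X_xi_independent (Some j)))
  (mxin_scalar aY (bdd_xi (Some j))) (bdd_X (Some j))).
by rewrite (mxmean_scalar (rv_xi (Some j))) cmean_real mean_xi mul_scalar_mx scale0r.
Qed.

Lemma mean_sqr_xi o : mean P (fun w => xi_ o w ^+ 2) = sigma_xi P xi ^+ 2.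
Proof.
have hs o' : bdd P measurable (fun w => (xi_ o' w ^+ 2)%:C).
  under eq_fun => w do rewrite rmorphXn /= expr2.
  exact: (funalgM alg (rv_xi o') (rv_xi o')).
have mX o' : measurable_fun setT (fun w => xi_ o' w ^+ 2).
  by apply: measurable_funX; exact: (model_rv model).
rewrite sqr_sqrtr; last first.
  apply: ae_mean_ge0; first exact: (bdd_Re_integrable (hs None)).
  by apply: aeW => w; rewrite sqr_ge0.
apply/esym/mean_same_law.
- exact: (mX None).
- exact: mX.
- exact: (bdd_Re_integrable (hs None)).
- exact: (bdd_Re_integrable (hs o)).
- move=> B mB; have mB' : measurable ((fun x : R => x ^+ 2) @^-1` B).
    have := @exprn_measurable R setT 2.
    by move=> /(_ measurableT B mB); rewrite setTI.
  exact: (xi_law o mB').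
Qed.

Lemma mean_sqr_X o : mxmean P (fun w => X_ o w *m X_ o w) = mxmean P (fun w => X w *m X w).
Proof.
have algm := @funalg_mfun R 'M[C]_m (mx_borel m).
apply/esym; apply: (mxmean_same_law (F := fun M => M *m M) (X_law o)).
- exact: (mxinM algm (@mfun_entries R m) (@mfun_entries R m)).
- exact: (mxinM alg (rv_X None) (rv_X None)).
- exact: (mxinM alg (rv_X o) (rv_X o)).
Qed.

Lemma mean_adj : (mxmean P X)^t* = mxmean P X.
Proof.
rewrite -(mxmean_adj (rv_X None)); congr mxmean; apply/funext => w.
exact: (X_adj None).
Qed.

Lemma mean_sqr_centered p (Z : T -> 'M[C]_p) : rvmx Z ->
  mxmean P (fun w => (Z w - mxmean P Z) *m (Z w - mxmean P Z)) =
  mxmean P (fun w => Z w *m Z w) - mxmean P Z *m mxmean P Z.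
Proof.
move=> hZ; set M := mxmean P Z.
have rM : rvmx (fun=> M) := mxin_cst alg M.
have rZZ := mxinM alg hZ hZ.
have rMZ := mxinM alg rM hZ.
have rZM := mxinM alg hZ rM.
have rMM := mxinM alg rM rM.
have -> : (fun w => (Z w - M) *m (Z w - M)) =
    (fun w => (Z w *m Z w - M *m Z w) - (Z w *m M - M *m M)).
  by apply/funext => w; rewrite mulmxBr !mulmxBl.
rewrite (mxmeanB (mxinB alg rZZ rMZ) (mxinB alg rZM rMM)) (mxmeanB rZZ rMZ) (mxmeanB rZM rMM).
by rewrite (mxmean_mull M hZ) (mxmean_mulr M hZ) mxmean_cst -/M subrr subr0.
Qed.

Lemma sqr_adj_mean p (Z : T -> 'M[C]_p) : rvmx Z -> (forall w, (Z w)^t* = Z w) ->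
  (mxmean P (fun w => Z w *m Z w))^t* = mxmean P (fun w => Z w *m Z w).
Proof.
move=> hZ Zadj; rewrite -(mxmean_adj (mxinM alg hZ hZ)); congr mxmean.
by apply/funext => w; rewrite adjM Zadj.
Qed.

Lemma psd_sigma_mx p (Z : T -> 'M[C]_p) : rvmx Z -> (forall w, (Z w)^t* = Z w) ->
  psd ((sigma_mx P Z ^+ 2)%:C%:M -
    mxmean P (fun w => (Z w - mxmean P Z) *m (Z w - mxmean P Z))).
Proof.
move=> hZ Zadj; rewrite /sigma_mx sqr_sqrtr ?opnorm_ge0//.
have Madj : (mxmean P Z)^t* = mxmean P Z.
  by rewrite -mxmean_adj//; congr mxmean; apply/funext => w.
apply: (opnorm_mxbound _).1; rewrite mean_sqr_centered//.
by rewrite adjB adjM Madj sqr_adj_mean.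
Qed.

(** [E (xi X)^2 = E xi^2 E X^2], and [E X^2] is the variance of [X] plus the square
    of its mean. *)
Definition noise_var := sigma_xi P xi ^+ 2 * (sigma_X P X ^+ 2 + opnorm (mxmean P X) ^+ 2).

Lemma psd_noise_var j :
  psd (noise_var%:C%:M - mxmean P (fun w => noise j w *m noise j w)).
Proof.
have aY := funalg_bdd P (FY (Some j)); have aX := funalg_bdd P (FX (Some j)).
have -> : mxmean P (fun w => noise j w *m noise j w) =
    (sigma_xi P xi ^+ 2)%:C *: mxmean P (fun w => X w *m X w).
  have -> : (fun w => noise j w *m noise j w) =
      (fun w => ((xis j w)%:C * (xis j w)%:C)%:M *m (Xs j w *m Xs j w)).
    apply/funext => w; rewrite mul_scalar_mx /noise -scalemxAl -scalemxAr scalerA.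
    by [].
  have hxx := funalgM aY (bdd_xi (Some j)) (bdd_xi (Some j)).
  have hXX := mxinM aX (bdd_X (Some j)) (bdd_X (Some j)).
  rewrite (mxmeanM (@events_measurable_xi (Some j)) (@events_measurable_X (Some j))
    (independentC (@X_xi_independent (Some j))) (mxin_scalar aY hxx) hXX).
  rewrite (mean_sqr_X (Some j)) (mxmean_scalar (funalgM alg (rv_xi (Some j)) (rv_xi (Some j)))).
  rewrite mul_scalar_mx -(mean_sqr_xi (Some j)) -cmean_real; congr (cmean P _ *: _).
  by apply/funext => w; rewrite rmorphXn /= expr2.
have h1 := psd_sigma_mx (rv_X None) (X_adj None).
rewrite (mean_sqr_centered (rv_X None)) in h1.
have h2 : psd ((opnorm (mxmean P X) ^+ 2)%:C%:M - mxmean P X *m mxmean P X).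
  have -> : (opnorm (mxmean P X) ^+ 2)%:C%:M - mxmean P X *m mxmean P X =
      mxfun (fun x => opnorm (mxmean P X) ^+ 2 + -1 * (x * x)) (mxmean P X).
    rewrite mxfunD mxfun_cst mxfunZ mxfunM (mxfun_id mean_adj) rmorphN1 scaleN1r.
    by [].
  apply/psd_mxfunP => i; rewrite mulN1r subr_ge0 -expr2 -[leLHS]real_normK ?num_real//.
  rewrite lerXn2r ?nnegrE ?opnorm_ge0//.
  exact: ((mxboundP _ mean_adj).1 (opnorm_mxbound mean_adj)).
have := psdZ (sqr_ge0 (sigma_xi P xi)) (psdD h1 h2).
rewrite /noise_var /sigma_X; set E := mxmean P (fun w => X w *m X w).
rewrite addrACA -opprD subrK -raddfD -rmorphD scalerBr scale_scalar_mx -rmorphM.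
by [].
Qed.

(** ** The quadratic term *)

Local Notation XX o := (fun w => X_ o w *t X_ o w).

Definition second_moment : 'M[C]_(m * m) := mxmean P (fun w => X w *t X w).

Definition quad_dev j w : 'M[C]_(m * m) := Xs j w *t Xs j w - second_moment.

Lemma rv_XX o : rvmx (XX o).
Proof. exact: (mxin_tens alg (rv_X o) (rv_X o)). Qed.

Lemma XX_adj o w : (X_ o w *t X_ o w)^t* = X_ o w *t X_ o w.
Proof. by rewrite adj_tens X_adj. Qed.

Lemma second_moment_adj : second_moment^t* = second_moment.
Proof.
rewrite -(mxmean_adj (rv_XX None)); congr mxmean; apply/funext => w.
exact: (XX_adj None).
Qed.

Lemma tens_sub_polarization (B D : 'M[C]_m) :
  (B *t B - D *t D) + (B *t B - D *t D) = (B - D) *t (B + D) + (B + D) *t (B - D).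
Proof. by apply/matrixP => i j; rewrite !mxE; ring. Qed.

Lemma tens_add_polarization (B D : 'M[C]_m) :
  (B *t B + D *t D) + (B *t B + D *t D) = (B - D) *t (B - D) + (B + D) *t (B + D).
Proof. by apply/matrixP => i j; rewrite !mxE; ring. Qed.

Lemma tens_scalar_scalar (a b : C) : (a%:M : 'M[C]_m) *t (b%:M : 'M[C]_m) = (a * b)%:M.
Proof.
apply/matrixP => i j; rewrite !mxE -(inj_eq (can_inj (@mxtens_unindexK m m))).
case: (mxtens_unindex i) (mxtens_unindex j) => [i1 i2] [j1 j2] /=.
rewrite xpair_eqE; case: (i1 == j1); case: (i2 == j2) => /=;
  by rewrite ?mulr1n ?mulr0n ?mulr0 ?mul0r.
Qed.

Lemma psd_half p (M : 'M[C]_p) : psd (M + M) -> psd M.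
Proof.
move=> h x; have := h x; rewrite mulmxDr mulmxDl mxE -mulr2n.
by rewrite pmulrn_lge0.
Qed.

(** Twice [U^2 + X (x) X] is the sum of the tensor squares of [U + X] and
    [U - X], and twice [U^2 - X (x) X] the sum of their two mixed products. *)
Lemma XX_bound o : {ae P, forall w, mxbound (U ^+ 2) (X_ o w *t X_ o w)}.
Proof.
apply: filterS (X_ev o) => w h; have hA := X_adj o w.
have [p1 p2] := (mxboundP U hA).2 h.
have Uadj : (U%:C%:M : 'M[C]_m)^t* = U%:C%:M by rewrite -scalemx1 adjZ adj1.
have UU : (U ^+ 2)%:C%:M = (U%:C%:M : 'M[C]_m) *t (U%:C%:M : 'M[C]_m).
  by rewrite tens_scalar_scalar -rmorphM expr2.
have Badj : (U%:C%:M - X_ o w)^t* = U%:C%:M - X_ o w by rewrite adjB hA Uadj.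
have Dadj : (U%:C%:M + X_ o w)^t* = U%:C%:M + X_ o w by rewrite adjD hA Uadj.
split; apply: psd_half; rewrite UU.
  rewrite tens_sub_polarization.
  by apply: psdD; apply: psd_tens.
rewrite tens_add_polarization.
by apply: psdD; apply: psd_tens.
Qed.

Lemma bdd_quad_dev j : mxin (bdd P (obs j)) (quad_dev j).
Proof.
have aj := funalg_bdd P (obs j).
exact: (mxinB aj (mxin_tens aj (obs_X j) (obs_X j)) (mxin_cst aj second_moment)).
Qed.

Lemma quad_dev_adj j w : (quad_dev j w)^t* = quad_dev j w.
Proof. by rewrite adjB (XX_adj (Some j)) second_moment_adj. Qed.

Lemma quad_dev_bound j : {ae P, forall w, mxbound (2 * U ^+ 2) (quad_dev j w)}.
Proof.
have rU : rvmx (fun=> (U ^+ 2)%:C%:M : 'M[C]_(m * m)) := mxin_cst alg _.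
have hX := rv_XX None; have hb := XX_bound None.
have M1 : psd ((U ^+ 2)%:C%:M - second_moment).
  have : psd (mxmean P (fun w => (U ^+ 2)%:C%:M - X w *t X w)).
    by apply: (psd_mxmean (mxinB alg rU hX)); apply: filterS hb => w [].
  by rewrite (mxmeanB rU hX) mxmean_cst.
have M2 : psd ((U ^+ 2)%:C%:M + second_moment).
  have : psd (mxmean P (fun w => (U ^+ 2)%:C%:M + X w *t X w)).
    by apply: (psd_mxmean (mxinD alg rU hX)); apply: filterS hb => w [].
  by rewrite (mxmeanD rU hX) mxmean_cst.
have e : (2 * U ^+ 2)%:C%:M = (U ^+ 2)%:C%:M + (U ^+ 2)%:C%:M :> 'M[C]_(m * m).
  by rewrite -raddfD -rmorphD; congr (_%:C%:M); ring.
apply: filterS (XX_bound (Some j)) => w [h1 h2]; rewrite /quad_dev; split; rewrite e.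
  by rewrite opprB (addrC second_moment) addrACA; exact: (psdD h1 M2).
by rewrite addrACA; exact: (psdD h2 M1).
Qed.

Lemma mean_XX o : mxmean P (XX o) = second_moment.
Proof.
have algm := @funalg_mfun R 'M[C]_m (mx_borel m).
apply/esym; apply: (mxmean_same_law (F := fun M => M *t M) (X_law o)).
- exact: (mxin_tens algm (@mfun_entries R m) (@mfun_entries R m)).
- exact: (rv_XX None).
- exact: (rv_XX o).
Qed.

Lemma mean_quad_dev j : mxmean P (quad_dev j) = 0.
Proof.
rewrite (mxmeanB (rv_XX (Some j)) (mxin_cst alg second_moment)) mxmean_cst.
by rewrite (mean_XX (Some j)) subrr.
Qed.

Lemma psd_quad_dev_var j :
  psd ((sigma_XX P X ^+ 2)%:C%:M - mxmean P (fun w => quad_dev j w *m quad_dev j w)).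
Proof.
have -> : mxmean P (fun w => quad_dev j w *m quad_dev j w) =
    mxmean P (fun w => (X w *t X w - second_moment) *m (X w *t X w - second_moment)).
  have algm := @funalg_mfun R 'M[C]_m (mx_borel m).
  have hM := mxinB algm (mxin_tens algm (@mfun_entries R m) (@mfun_entries R m))
    (mxin_cst algm second_moment).
  have hq o := mxinB alg (rv_XX o) (mxin_cst alg second_moment).
  apply/esym; apply: (mxmean_same_law
    (F := fun M => (M *t M - second_moment) *m (M *t M - second_moment)) (X_law (Some j))).
  - exact: (mxinM algm hM hM).
  - exact: (mxinM alg (hq None) (hq None)).
  - exact: (mxinM alg (hq (Some j)) (hq (Some j))).
exact: (psd_sigma_mx (rv_XX None) (XX_adj None)).
Qed.

(** ** The two deviation events *)

Lemma noise_concentration tau : 0 < tau -> (0 < m)%N ->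
  exists E : set T, [/\ measurable E,
    ((1 - 4 * m%:R * expR (- tau))%:E <= P E)%E &
    forall w, E w -> mxbound (6 * (Num.sqrt (n%:R * noise_var * tau) + c_xi * U * tau))
      (\sum_j noise j w)].
Proof.
move=> tau0 m0; apply: (matrix_bernstein obs_measurable obs_independent bdd_noise
  noise_adj noise_bound mean_noise psd_noise_var) => //; first exact: mulr_gt0.
by rewrite mulr_ge0 ?addr_ge0 ?sqr_ge0.
Qed.

Lemma quad_concentration tau : 0 < tau -> (0 < m)%N ->
  exists E : set T, [/\ measurable E,
    ((1 - 4 * (m * m)%:R * expR (- tau))%:E <= P E)%E &
    forall w, E w ->
      mxbound (6 * (Num.sqrt (n%:R * sigma_XX P X ^+ 2 * tau) + 2 * U ^+ 2 * tau))
      (\sum_j quad_dev j w)].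
Proof.
move=> tau0 m0; apply: (matrix_bernstein obs_measurable obs_independent bdd_quad_dev
  quad_dev_adj quad_dev_bound mean_quad_dev psd_quad_dev_var) => //.
- by rewrite mulr_gt0// exprn_gt0.
- by rewrite sqr_ge0.
- by rewrite muln_gt0 m0.
Qed.

(** Squares of [<A, B>] are linear in [B (x) B], so that the empirical and the
    population norm of [A] are pairings with averages of [X (x) X]. *)
Lemma sqr_tr_adj (A B : 'M[C]_m) : A^t* = A -> B^t* = B ->
  Re (\tr (A *m B)) ^+ 2 = Re (\tr ((A *t A) *m (B *t B))).
Proof.
move=> hA hB; rewrite tensmx_mul tr_tens.
have : Num.conj (\tr (A *m B)) = \tr (A *m B).
  by rewrite -tr_adj adjM hA hB mxtrace_mulC.
case: (\tr _) => a b [] /eqP; rewrite -subr_eq0 -opprD oppr_eq0 -mulr2n mulrn_eq0 /=.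
by move=> /eqP ->; rewrite mul0r subr0 expr2.
Qed.

Lemma L2norm_sqr (A : 'M[C]_m) : A^t* = A ->
  L2norm P X A ^+ 2 = Re (\tr ((A *t A) *m second_moment)).
Proof.
move=> hA; have rAX := mxinM alg (mxin_cst alg (A *t A)) (rv_XX None).
have e w : nc (hs_inner A (X w)) ^+ 2 = Re (\tr ((A *t A) *m (X w *t X w))).
  rewrite /hs_inner (X_adj None) -sqr_tr_adj//; last exact: (X_adj None).
  have : Num.conj (\tr (A *m X w)) = \tr (A *m X w).
    by rewrite -tr_adj adjM hA (X_adj None) mxtrace_mulC.
  case: (\tr _) => a b [] /eqP; rewrite -subr_eq0 -opprD oppr_eq0 -mulr2n mulrn_eq0 /=.
  by move=> /eqP ->; rewrite expr0n addr0 sqrtr_sqr real_normK ?num_real.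
rewrite sqr_sqrtr; last first.
  rewrite (_ : (fun w => _) = fun w => Re (\tr ((A *t A) *m (X w *t X w)))); last first.
    by apply/funext.
  apply: ae_mean_ge0; first exact: (bdd_Re_integrable (funalg_tr alg rAX)).
  by apply: aeW => w; rewrite -e sqr_ge0.
rewrite -(mxmean_mull _ (rv_XX None)) (tr_mxmean rAX) /=.
by congr mean; apply/funext => w; rewrite e.
Qed.

End Observations.

(** * The penalized least squares estimator *)

Section Estimator.
Context {R : realType}.
Local Notation C := R[i].
Variables (m n : nat).
Implicit Types A B S : 'M[C]_m.

Lemma Re_trB A B D : Re (\tr ((A - B) *m D)) = Re (\tr (A *m D)) - Re (\tr (B *m D)).
Proof. by rewrite mulmxBl mxtraceD mxtraceN ReB. Qed.

(** A difference of density matrices has trace norm at most 2. *)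
Lemma density_diff_tr_le A B D V : density A -> density B -> mxbound V D ->
  `|Re (\tr ((A - B) *m D))| <= 2 * V.
Proof.
move=> dA dB hD; rewrite Re_trB.
have h E : density E -> `|Re (\tr (E *m D))| <= V.
  move=> dE; have := tr_psd_mxbound (density_adj dE) (density_psd dE) hD.
  by rewrite density_tr// mulr1.
apply: le_trans (ler_normB _ _) _; rewrite mulrDl !mul1r.
by apply: lerD; exact: h.
Qed.

Lemma density_diff_adj A B : density A -> density B -> (A - B)^t* = A - B.
Proof. by move=> dA dB; rewrite adjB !density_adj. Qed.

Lemma density_diff_tens_tr_le A B (D : 'M[C]_(m * m)) V :
  density A -> density B -> mxbound V D ->
  `|Re (\tr (((A - B) *t (A - B)) *m D))| <= 4 * V.
Proof.
move=> dA dB hD.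
have h E F : density E -> density F -> `|Re (\tr ((E *t F) *m D))| <= V.
  move=> dE dF; have dEF := density_tens dE dF.
  have := tr_psd_mxbound (density_adj dEF) (density_psd dEF) hD.
  by rewrite density_tr// mulr1.
have -> : (A - B) *t (A - B) = (A *t A - A *t B) - (B *t A - B *t B).
  by apply/matrixP => i j; rewrite !mxE; ring.
have split2 (E F : 'M[C]_(m * m)) :
    Re (\tr ((E - F) *m D)) = Re (\tr (E *m D)) - Re (\tr (F *m D)).
  by rewrite mulmxBl mxtraceD mxtraceN ReB.
rewrite (split2 (A *t A - A *t B)) (split2 (A *t A)) (split2 (B *t A)).
have -> : 4 * V = V + V + (V + V) by ring.
apply: le_trans (ler_normB _ _) (lerD _ _);
  by apply: le_trans (ler_normB _ _) (lerD _ _); exact: h.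
Qed.

Lemma mix_entropy_le (s h hr hS l : R) : 0 <= s -> h <= (1 - s) * hr + s * hS ->
  - l <= hr -> hS <= 0 -> h <= hr + s * l.
Proof.
move=> s0 hh h1 h2; apply: le_trans hh _.
have -> : (1 - s) * hr + s * hS = hr + s * (hS - hr) by ring.
by rewrite lerD2l ler_wpM2l// lerBlDr -[leLHS]addr0 -(subrr hr); lra.
Qed.

Lemma first_order_scalar (s A B a eps hr h l : R) : 0 < s -> 0 <= eps ->
  h <= hr + s * l -> a + eps * hr <= a - 2 * s * A + s ^+ 2 * B + eps * h ->
  2 * A <= s * B + eps * l.
Proof.
move=> s0 e0 hh hm; rewrite -(ler_pM2l s0).
have := ler_wpM2l e0 hh; rewrite mulrDr mulrCA => h1.
have -> : s * (2 * A) = 2 * s * A by ring.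
have -> : s * (s * B + eps * l) = s ^+ 2 * B + s * (eps * l) by ring.
by lra.
Qed.

(** The first-order condition at the minimizer [r] in the direction of [S].
    Convexity of the entropy along the segment from [r] to [S] stands in for its
    derivative; since the entropy of a density matrix lies between [- log m]
    and [0], the penalty contributes at most [eps log m]. *)
Lemma argmin_variational (Y : 'I_n -> R) (x : 'I_n -> 'M[C]_m) eps r S :
  (0 < m)%N -> 0 <= eps ->
  is_argmin (@density R m) (objective Y x eps) r -> density S ->
  2 * (n%:R^-1 * \sum_j (Y j - Re (\tr (r *m x j))) *
       (Re (\tr (S *m x j)) - Re (\tr (r *m x j)))) <= eps * ln m%:R.
Proof.
move=> m0 e0 [dr rmin] dS.
pose a j := Y j - Re (\tr (r *m x j)).
pose b j := Re (\tr (S *m x j)) - Re (\tr (r *m x j)).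
pose A := n%:R^-1 * \sum_j a j * b j; pose B := n%:R^-1 * \sum_j b j ^+ 2.
rewrite -/A; have ni0 : 0 <= n%:R^-1 :> R by rewrite invr_ge0.
have B0 : 0 <= B by rewrite mulr_ge0// sumr_ge0// => j _; rewrite sqr_ge0.
have key s : 0 < s <= 1 -> 2 * A <= s * B + eps * ln m%:R.
  move=> /andP[s0 s1]; have s01 : 0 <= s <= 1 by rewrite ltW.
  have := rmin _ (density_mix s01 dr dS); rewrite /objective.
  have -> : \sum_j (Y j - Re (\tr (((1 - s)%:C *: r + s%:C *: S) *m x j))) ^+ 2 =
      \sum_j a j ^+ 2 - 2 * s * (\sum_j a j * b j) + s ^+ 2 * \sum_j b j ^+ 2.
    rewrite !mulr_sumr -sumrB -big_split; apply: eq_bigr => j _ /=.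
    rewrite mulmxDl -!scalemxAl mxtraceD !mxtraceZ ReD !ReZ /a /b; ring.
  have hH := mix_entropy_le (ltW s0) (tr_xlogx_mix_le s01 dr dS)
    (tr_xlogx_ge m0 dr) (tr_xlogx_le0 dS).
  have -> : n%:R^-1 * (\sum_j a j ^+ 2 - 2 * s * (\sum_j a j * b j) +
      s ^+ 2 * \sum_j b j ^+ 2) = n%:R^-1 * (\sum_j a j ^+ 2) - 2 * s * A + s ^+ 2 * B.
    by rewrite /A /B; ring.
  exact: first_order_scalar.
apply/ler_addgt0Pl => e ep.
have B1 : 0 < B + 1 by rewrite ltr_wpDl.
pose s := Num.min 1 (e / (B + 1)).
have s01 : 0 < s <= 1 by rewrite lt_min ltr01 divr_gt0//= ge_min lexx.
apply: le_trans (key s s01) _; rewrite lerD2r.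
apply: (@le_trans _ _ (e / (B + 1) * B)).
  by rewrite ler_wpM2r// ge_min lexx orbT.
by rewrite mulrAC ler_pdivrMr// ler_pM2l// lerDl.
Qed.

(** With [Y j = <rho, x j> + z j], the polarization identity turns the first
    order condition into a comparison of squared empirical norms. *)
Lemma estimator_basic_inequality rho (x : 'I_n -> 'M[C]_m) (z : 'I_n -> R) eps r S :
  (0 < m)%N -> 0 <= eps -> density S ->
  is_argmin (@density R m)
    (objective (fun j => Re (\tr (rho *m x j)) + z j) x eps) r ->
  n%:R^-1 * (\sum_j Re (\tr ((r - rho) *m x j)) ^+ 2) +
  n%:R^-1 * (\sum_j Re (\tr ((r - S) *m x j)) ^+ 2) <=
  n%:R^-1 * (\sum_j Re (\tr ((S - rho) *m x j)) ^+ 2) +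
  2 * (n%:R^-1 * Re (\tr ((r - S) *m (\sum_j (z j)%:C *: x j)))) + eps * ln m%:R.
Proof.
move=> m0 e0 dS rmin; have := argmin_variational m0 e0 rmin dS.
have -> : Re (\tr ((r - S) *m (\sum_j (z j)%:C *: x j))) =
    \sum_j z j * (Re (\tr (r *m x j)) - Re (\tr (S *m x j))).
  rewrite mulmx_sumr (big_morph _ (@mxtraceD C m) (mxtrace0 C m)) Re_sum.
  by apply: eq_bigr => j _; rewrite -scalemxAr mxtraceZ ReZ Re_trB.
rewrite -(lerD2l (n%:R^-1 * (\sum_j Re (\tr ((S - rho) *m x j)) ^+ 2) +
  2 * (n%:R^-1 * \sum_j z j * (Re (\tr (r *m x j)) - Re (\tr (S *m x j)))))).
apply: le_trans; rewrite le_eqVlt; apply/orP; left; apply/eqP.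
rewrite -!mulrDr mulrCA -mulrDr [2 * (_^-1 * _)]mulrCA -mulrDr; congr (_ * _).
rewrite !mulr_sumr -!big_split; apply: eq_bigr => j _ /=; rewrite !Re_trB.
by move: (Re _) (Re _) (Re _) (z j) => p q u v; ring.
Qed.

End Estimator.

(** * The oracle inequality *)

Section Oracle.
Context {R : realType}.
Local Notation C := R[i].

(** The Bernstein bound at [tau = 3 n r], divided by [n]; [v <= 2 s ^ 2] allows
    for the two summands of [noise_var]. *)
Lemma deviation_scale (n : nat) (v s V r : R) : (0 < n)%N -> 0 <= s -> 0 <= r ->
  v <= 2 * s ^+ 2 ->
  n%:R^-1 * (6 * (Num.sqrt (n%:R * v * (3 * (n%:R * r))) + V * (3 * (n%:R * r)))) <=
  6 * (4 * (s * Num.sqrt r) + 3 * (V * r)).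
Proof.
move=> n0 s0 r0 vs; have n0' : 0 < n%:R :> R by rewrite ltr0n.
have -> : n%:R * v * (3 * (n%:R * r)) = n%:R ^+ 2 * (3 * v * r) by ring.
rewrite sqrtrM ?sqr_ge0// sqrtr_sqr ger0_norm//.
have -> : n%:R^-1 * (6 * (n%:R * Num.sqrt (3 * v * r) + V * (3 * (n%:R * r)))) =
    6 * (Num.sqrt (3 * v * r) + 3 * (V * r)) by field; rewrite gt_eqF.
rewrite ler_pM2l// lerD2r.
have h : 0 <= 4 * (s * Num.sqrt r) by rewrite !mulr_ge0 ?sqrtr_ge0.
rewrite -(ger0_norm h) -sqrtr_sqr ler_wsqrtr// !exprMn sqr_sqrtr//.
have s2 := sqr_ge0 s.
have : v * r <= 2 * s ^+ 2 * r by rewrite ler_wpM2r.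
have : 0 <= s ^+ 2 * r by rewrite mulr_ge0.
by move: (s ^+ 2) => q; clear; lra.
Qed.

(** The factor 3 in the exponent turns [exp (- log (2 m))] into a cube, which
    absorbs the prefactors [m] and [m ^ 2] of the two Bernstein inequalities. *)
Lemma failure_probability (m : nat) (t : R) : (0 < m)%N -> 0 < t ->
  4 * m%:R * expR (- (3 * (t + ln (2 * m%:R)))) +
  4 * (m * m)%:R * expR (- (3 * (t + ln (2 * m%:R)))) <= expR (- t).
Proof.
move=> m0 t0; set e := expR (- (3 * _)).
have m1 : 1 <= m%:R :> R by rewrite ler1n.
have M0 : 0 < 2 * m%:R :> R by lra.
set x := expR (- t); have x0 : 0 < x := expR_gt0 _.
have x1 : x <= 1 by rewrite /x -expR0 ler_expR oppr_le0 ltW.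
have eE : e = (x / (2 * m%:R)) ^+ 3.
  rewrite /e -mulrN opprD expRM_natl expRD -/x; congr ((_ * _) ^+ 3).
  by rewrite expRN lnK.
rewrite eE natrM; clear eE e; move: x0 x1 m1 M0; move: x (m%:R); clear => x M x0 x1 M1 M0.
have -> : 4 * M * (x / (2 * M)) ^+ 3 + 4 * (M * M) * (x / (2 * M)) ^+ 3 =
    x ^+ 3 * (M + 1) / (2 * M ^+ 2).
  by field; rewrite gt_eqF//; lra.
have x3 : x ^+ 3 <= x by rewrite -[leRHS]expr1 ler_wiXn2l// ltW.
rewrite ler_pdivrMr; last by rewrite mulr_gt0// exprn_gt0//; lra.
apply: ler_pM => //; first by rewrite exprn_ge0// ltW.
- by lra.
- by rewrite expr2; nra.
Qed.

(** Three norm comparisons and the noise cost [3 * 240 + 2 * 84 = 888]. *)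
Lemma oracle_combine (Lr Ls L0 qr qs q0 z e B : R) :
  Lr <= qr + 240 * B -> Ls <= qs + 240 * B -> q0 <= L0 + 240 * B -> z <= 84 * B ->
  qr + qs <= q0 + 2 * z + e -> Lr + Ls <= L0 + e + 888 * B.
Proof. by move=> h1 h2 h3 h4 h5; lra. Qed.

Lemma max_absorb (e x y B : R) :
  0 <= e -> e <= x -> x <= y -> B <= y -> e + 888 * B <= 1000 * y.
Proof. by move=> h1 h2 h3 h4; lra. Qed.

Lemma oracle_split (Lr Ls L0 e B y z : R) : 0 <= Lr -> 0 <= Ls ->
  Lr + Ls <= L0 + e + 888 * B -> e + 888 * B <= 1000 * y -> y <= z ->
  Ls <= L0 + 1000 * z /\ Lr <= L0 + 1000 * z.
Proof. by move=> h1 h2 h3 h4 h5; split; lra. Qed.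

(** On one event, for all penalties [eps], oracles [S] and minimizers [r] at
    once: the basic inequality holds for the empirical norms, which differ from
    the [L2]-norms by the deviation of the second moment, while the noise enters
    through [<r - S, sum xi_j X_j>]. *)
Lemma oracle_event (m n : nat) (d : measure_display) (T : measurableType d)
    (P : probability T R) (rho : 'M[C]_m)
    (X : T -> 'M[C]_m) (Xs : 'I_n -> T -> 'M[C]_m)
    (xi : T -> R) (xis : 'I_n -> T -> R) (U c_xi t : R)
    (rate := (t + ln (2 * m%:R)) / n%:R)
    (s := Num.max (sigma_xi P xi * sigma_X P X)
             (Num.max (sigma_xi P xi * opnorm (mxmean P X)) (sigma_XX P X)))
    (B := Num.max (s * Num.sqrt rate) (Num.max (c_xi * U) (U ^+ 2) * rate)) :
  (0 < m)%N -> (0 < n)%N -> density rho -> sampling_model P X Xs xi xis ->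
  0 < U -> 0 < c_xi ->
  {ae P, forall w, opnorm (X w) <= U} -> {ae P, forall w, `|xi w| <= c_xi} -> 0 < t ->
  exists E : set T, [/\ measurable E, ((1 - expR (- t))%:E <= P E)%E &
    forall w, E w -> forall eps S r, 0 <= eps -> density S ->
    is_argmin (@density R m)
      (objective (fun j => response rho Xs xis j w) (fun j => Xs j w) eps) r ->
    L2norm P X (r - rho) ^+ 2 + L2norm P X (r - S) ^+ 2 <=
    L2norm P X (S - rho) ^+ 2 + eps * ln m%:R + 888 * B].
Proof.
move=> m0 n0 drho model U0 c0 XU xic t0.
have n0' : 0 < n%:R :> R by rewrite ltr0n.
have m1 : 1 <= m%:R :> R by rewrite ler1n.
have l0 : 0 <= ln (2 * m%:R) :> R by rewrite ln_ge0//; lra.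
pose tau := 3 * (t + ln (2 * m%:R)).
have tau0 : 0 < tau by rewrite mulr_gt0// ltr_wpDr.
have [E1 [mE1 PE1 hE1]] := noise_concentration model U0 c0 XU xic tau0 m0.
have [E2 [mE2 PE2 hE2]] := quad_concentration model U0 XU tau0 m0.
set b1 := 6 * _ in hE1; set b2 := 6 * _ in hE2.
exists (E1 `&` E2); split; first exact: measurableI.
  have fP (A : set T) : measurable A -> P A = (fine (P A))%:E.
    by move=> mA; rewrite fineK// fin_num_measure.
  have mE1c := measurableC mE1; have mE2c := measurableC mE2.
  have : (P (~` (E1 `&` E2)) <= P (~` E1) + P (~` E2))%E.
    by rewrite setCI; exact: measureU2.
  rewrite !probability_setC//; last exact: measurableI.
  move: PE1 PE2; rewrite (fP _ mE1) (fP _ mE2) (fP _ (measurableI _ _ mE1 mE2)).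
  rewrite -!EFinB -EFinD !lee_fin.
  have := failure_probability m0 t0; rewrite -/tau.
  move: (4 * m%:R * expR (- tau)) (4 * (m * m)%:R * expR (- tau)) (expR (- t)).
  move: (fine (P E1)) (fine (P E2)) (fine (P (E1 `&` E2))).
  by clear => e1 e2 e3 p1 p2 p3; lra.
move=> w [/hE1 H1 /hE2 H2] eps S r eps0 dS rmin.
have dr : density r by case: rmin.
have basic := estimator_basic_inequality m0 eps0 dS rmin.
have rate0 : 0 <= rate by rewrite divr_ge0 ?ltW// ltr_wpDr.
have s0 : 0 <= s.
  by rewrite le_max; apply/orP; left; rewrite mulr_ge0 ?sqrtr_ge0.
have tauE : tau = 3 * (n%:R * rate) by rewrite /tau /rate; field; rewrite gt_eqF.
have sB : s * Num.sqrt rate <= B by rewrite le_max lexx.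
have WB : Num.max (c_xi * U) (U ^+ 2) * rate <= B by rewrite le_max lexx orbT.
have cUB : c_xi * U * rate <= B.
  by apply: le_trans WB; rewrite ler_wpM2r// le_max lexx.
have UUB : 2 * U ^+ 2 * rate <= 2 * B.
  rewrite -mulrA ler_pM2l//.
  by apply: le_trans WB; rewrite ler_wpM2r// le_max lexx orbT.
have sX0 : 0 <= sigma_xi P xi * sigma_X P X by rewrite mulr_ge0 ?sqrtr_ge0.
have sE0 : 0 <= sigma_xi P xi * opnorm (mxmean P X).
  by rewrite mulr_ge0 ?sqrtr_ge0 ?opnorm_ge0.
have d1 : n%:R^-1 * b1 <= 42 * B.
  apply: (@le_trans _ _ (6 * (4 * (s * Num.sqrt rate) + 3 * (c_xi * U * rate)))).
    rewrite /b1 tauE; apply: deviation_scale => //.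
    rewrite /noise_var mulrDr -!exprMn mulr_natl mulr2n.
    by apply: lerD; rewrite lerXn2r ?nnegrE// !le_max lexx ?orbT.
  by move: sB cUB; clear; lra.
have d2 : n%:R^-1 * b2 <= 60 * B.
  apply: (@le_trans _ _ (6 * (4 * (s * Num.sqrt rate) + 3 * (2 * U ^+ 2 * rate)))).
    rewrite /b2 tauE; apply: deviation_scale => //.
    have : sigma_XX P X ^+ 2 <= s ^+ 2.
      by rewrite lerXn2r ?nnegrE ?sqrtr_ge0// !le_max lexx !orbT.
    by have := sqr_ge0 s; move: (s ^+ 2) (_ ^+ 2); clear => x y; lra.
  by move: sB UUB; clear; lra.
have ni0 : 0 <= n%:R^-1 :> R by rewrite invr_ge0 ltW.
have norm A1 A2 : density A1 -> density A2 ->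
    L2norm P X (A1 - A2) ^+ 2 <=
      n%:R^-1 * (\sum_j Re (\tr ((A1 - A2) *m Xs j w)) ^+ 2) + 240 * B /\
    n%:R^-1 * (\sum_j Re (\tr ((A1 - A2) *m Xs j w)) ^+ 2) <=
      L2norm P X (A1 - A2) ^+ 2 + 240 * B.
  move=> dA1 dA2.
  suff : `|n%:R^-1 * (\sum_j Re (\tr ((A1 - A2) *m Xs j w)) ^+ 2) -
      L2norm P X (A1 - A2) ^+ 2| <= 240 * B.
    move: (n%:R^-1 * _) (L2norm _ _ _ ^+ 2) (240 * B); clear => x y z.
    by rewrite ler_norml => /andP[h1 h2]; split; lra.
  have hA := density_diff_adj dA1 dA2.
  rewrite (L2norm_sqr model U0 XU hA).
  have -> : \sum_j Re (\tr ((A1 - A2) *m Xs j w)) ^+ 2 =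
      Re (\tr (((A1 - A2) *t (A1 - A2)) *m (\sum_j quad_dev P X Xs j w))) +
      n%:R * Re (\tr (((A1 - A2) *t (A1 - A2)) *m second_moment P X)).
    rewrite mulmx_sumr (big_morph _ (@mxtraceD C (m * m)) (mxtrace0 C (m * m))) Re_sum.
    rewrite mulr_natl -[in X in _ *+ X](card_ord n) -sumr_const -big_split.
    apply: eq_bigr => j _ /=; rewrite /quad_dev mulmxBr mxtraceD mxtraceN ReB subrK.
    by apply: sqr_tr_adj => //; exact: (X_adj model (Some j)).
  rewrite mulrDr mulKf ?gt_eqF// addrK normrM (ger0_norm ni0).
  apply: (@le_trans _ _ (n%:R^-1 * (4 * b2))).
    by rewrite ler_wpM2l//; exact: density_diff_tens_tr_le.
  by rewrite (mulrCA _ 4); move: (n%:R^-1 * b2) d2; clear => x; lra.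
have noise_le : n%:R^-1 * Re (\tr ((r - S) *m (\sum_j (xis j w)%:C *: Xs j w))) <= 84 * B.
  apply: (@le_trans _ _ (n%:R^-1 * (2 * b1))).
    rewrite ler_wpM2l//; apply: le_trans (ler_norm _) _.
    exact: density_diff_tr_le dr dS H1.
  by rewrite (mulrCA _ 2); move: (n%:R^-1 * b1) d1; clear => x; lra.
have [h1 _] := norm _ _ dr drho; have [h2 _] := norm _ _ dr dS.
have [_ h3] := norm _ _ dS drho.
exact: oracle_combine h1 h2 h3 noise_le basic.
Qed.

End Oracle.

Theorem theorem4 (R : realType) :
  exists C : R, 0 < C /\
  forall (m n : nat) (d : measure_display) (T : measurableType d)
    (P : probability T R) (rho : 'M[R[i]]_m)
    (X : T -> 'M[R[i]]_m) (Xs : 'I_n -> T -> 'M[R[i]]_m)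
    (xi : T -> R) (xis : 'I_n -> T -> R) (U c_xi : R),
  (0 < m)%N -> (0 < n)%N -> density rho ->
  sampling_model P X Xs xi xis ->
  0 < U -> 0 < c_xi ->
  {ae P, forall w, opnorm (X w) <= U} ->
  {ae P, forall w, `|xi w| <= c_xi} ->
  let L2 := L2norm P X in
  let rate (t : R) := (t + ln (2 * m%:R)) / n%:R in
  let s := Num.max (sigma_xi P xi * sigma_X P X)
             (Num.max (sigma_xi P xi * opnorm (mxmean P X)) (sigma_XX P X)) in
  let bound (t eps : R) (S : 'M[R[i]]_m) :=
    Num.max (entropy_term P X eps S)
      (Num.max (L2 (S - rho) * U * Num.sqrt (rate t))
        (Num.max (s * Num.sqrt (rate t))
                 (Num.max (c_xi * U) (U ^+ 2) * rate t))) in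
  (forall (t eps : R) (S : 'M[R[i]]_m) (rho_hat : T -> 'M[R[i]]_m),
     0 < t -> 0 <= eps -> density S -> is_estimator rho Xs xis eps rho_hat ->
     with_prob_ge P (1 - expR (- t)) (fun w =>
       L2 (rho_hat w - S) ^+ 2 <= L2 (S - rho) ^+ 2 + C * bound t eps S /\
       L2 (rho_hat w - rho) ^+ 2 <= L2 (S - rho) ^+ 2 + C * bound t eps S)) /\
  (forall (t eps : R) (rho_hat : T -> 'M[R[i]]_m),
     0 < t -> 0 <= eps -> is_estimator rho Xs xis eps rho_hat ->
     with_prob_ge P (1 - expR (- t)) (fun w =>
       L2 (rho_hat w - rho) ^+ 2 <=
       C * Num.max (entropy_term P X eps rho)
             (Num.max (s * Num.sqrt (rate t))
                      (Num.max (c_xi * U) (U ^+ 2) * rate t)))).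
Proof.
exists 1000; split; first by rewrite ltr0n.
move=> m n d T P rho X Xs xi xis U c_xi m0 n0 drho model U0 c0 XU xic L2 rate s bound.
have event (t : R) (t0 : 0 < t) :=
  oracle_event m0 n0 drho model U0 c0 XU xic t0.
have tail (eps B : R) (S : 'M[R[i]]_m) : 0 <= eps -> density S ->
    eps * ln m%:R + 888 * B <= 1000 * Num.max (entropy_term P X eps S) B.
  move=> eps0 dS; apply: (@max_absorb _ _ (entropy_term P X eps S)).
  - by rewrite mulr_ge0// ln_ge0// ler1n.
  - exact: entropy_term_ge.
  - by rewrite le_max lexx.
  - by rewrite le_max lexx orbT.
split=> [t eps S rho_hat t0 eps0 dS est|t eps rho_hat t0 eps0 est].
  have [E [mE PE hE]] := event t t0; exists E; split=> // w Ew.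
  apply: (oracle_split (sqr_ge0 _) (sqr_ge0 _) (hE w Ew eps S _ eps0 dS (est w))
    (tail _ _ _ eps0 dS)).
  rewrite /bound ge_max; apply/andP; split; first by rewrite le_max lexx.
  by rewrite le_max; apply/orP; right; rewrite le_max; apply/orP; right; exact: lexx.
have [E [mE PE hE]] := event t t0; exists E; split=> // w Ew.
have [_] := oracle_split (sqr_ge0 _) (sqr_ge0 _)
  (hE w Ew eps rho _ eps0 drho (est w)) (tail _ _ _ eps0 drho) (lexx _).
have L0 : L2norm P X (rho - rho) ^+ 2 = 0.
  rewrite (L2norm_sqr model U0 XU); last by rewrite subrr trmx0 map_mx0.
  by rewrite subrr tensmx0 mul0mx mxtrace0.
by rewrite [X in _ <= X + _]L0 add0r.
Qed.
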